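(* Let $X$ be a second countable Peano continuum and let $f : X \to \mathbb{R}$ be a continuous map. Then the Reeb space $W_f$ of $f$ has the structure of a finite graph (i.e., is homeomorphic to a finite graph) if and only if every contour of $f$ has a star-like open neighborhood (i.e., is contained in a star-like open subset of $X$).
   Context: A Peano continuum is a non-empty compact, connected and locally connected Hausdorff space. Reeb space: for $x_0, x_1 \in X$ write $x_0 \sim x_1$ if $f(x_0) = f(x_1)$ and $x_0, x_1$ belong to the same connected component of the level set $f^{-1}(f(x_0))$. The Reeb space is the quotient space $W_f = X/\!\sim$ with the quotient topology, and $q_f : X \to W_f$ is the quotient map. A contour of $f$ is a connected component of a level set $f^{-1}(t)$, $t \in \mathbb{R}$. A subset $A \subset X$ is saturated if it is a union of contours, i.e. $q_f^{-1}(q_f(A)) = A$. A non-empty open, connected and saturated subset $U$ of $X$ is cylindrical if for every $z \in q_f(U)$ the set $U \setminus q_f^{-1}(z)$ has exactly two connected components. An open, connected and saturated subset $U$ of $X$ is star-like if for some contour $L \subset U$ of $f$, the set $U \setminus L$ is a finite (possibly empty) disjoint union of cylindrical subsets. A finite graph means a finite multi-graph, possibly with multiple edges and/or loops, and possibly with isolated vertices; as a topological space it is a compact (equivalently, finite) CW complex of dimension at most $1$. *)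

(* Defs.v *)
From HB Require Import structures.
From mathcomp Require Import all_boot all_order all_algebra generic_quotient.
From mathcomp Require Import all_classical all_reals all_analysis.
Import Order.TTheory GRing.Theory Num.Theory.
Import numFieldNormedType.Exports.

Set Implicit Arguments.
Unset Strict Implicit.
Unset Printing Implicit Defensive.

Local Open Scope classical_set_scope.
Local Open Scope ring_scope.
Local Open Scope quotient_scope.

Definition locally_connected (X : topologicalType) : Prop :=
  forall (x : X) (U : set X), nbhs x U ->
    exists V : set X, [/\ open V, connected V, V x & V `<=` U].

(* [connected] holds of the empty set, hence the explicit non-emptiness. *)
Definition peano_continuum (X : topologicalType) : Prop :=
  [/\ [set: X] !=set0, compact [set: X], connected [set: X],
      locally_connected X & hausdorff_space X].

Definition homeomorphic (X Y : topologicalType) : Prop :=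
  exists (h : X -> Y) (k : Y -> X),
    [/\ cancel h k, cancel k h, continuous h & continuous k].

Section contours.
Context {R : realType} {X : topologicalType} (f : X -> R).

Definition contour_of (x : X) : set X :=
  connected_component (f @^-1` [set f x]) x.

Definition contour (L : set X) : Prop := exists x : X, L = contour_of x.

Definition reeb_eq (x y : X) : bool := `[< f x = f y /\ contour_of x y >].

Lemma reeb_eq_refl : reflexive reeb_eq.
Proof.
by move=> x; apply/asboolP; split=> //; exact: connected_component_refl.
Qed.

Lemma reeb_eq_sym : symmetric reeb_eq.
Proof.
suff H x y : reeb_eq x y -> reeb_eq y x by move=> x y; apply/idP/idP; exact: H.
move=> /asboolP[fxy xy]; apply/asboolP; split=> //.
by rewrite /contour_of -fxy; exact: connected_component_sym.
Qed.

Lemma reeb_eq_trans : transitive reeb_eq.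
Proof.
move=> y x z /asboolP[fxy xy] /asboolP[fyz yz]; apply/asboolP.
split; first by rewrite fxy.
by apply: connected_component_trans xy _; rewrite fxy.
Qed.

Definition reeb_rel := EquivRel reeb_eq reeb_eq_refl reeb_eq_sym reeb_eq_trans.

Definition reeb_space := {eq_quot reeb_rel}.

HB.instance Definition _ :=
  Topological.copy reeb_space (quotient_topology reeb_space).
HB.instance Definition _ := Quotient.on reeb_space.

Definition reeb_quot : X -> reeb_space := \pi_reeb_space.

Definition saturated (A : set X) : Prop :=
  reeb_quot @^-1` (reeb_quot @` A) = A.

Definition components (A : set X) : set (set X) := connected_component A @` A.

Definition cylindrical (U : set X) : Prop :=
  [/\ U !=set0, open U, connected U, saturated U &
      forall z : reeb_space, (reeb_quot @` U) z ->
        (components (U `\` reeb_quot @^-1` [set z]) #= `I_2)%card].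

Definition star_like (U : set X) : Prop :=
  [/\ open U, connected U, saturated U &
      exists L : set X, [/\ contour L, L `<=` U &
        exists (n : nat) (C : 'I_n -> set X),
          [/\ forall i, cylindrical (C i), trivIset [set: 'I_n] C &
              U `\` L = \bigcup_(i in [set: 'I_n]) C i]]].

End contours.

(* Loops (equal ends), parallel edges and isolated vertices are allowed; the
   order of the ends only parametrizes the edge. *)
Record finite_multigraph := FiniteMultigraph {
  vertex : finType;
  edge : finType;
  edge_src : edge -> vertex;
  edge_tgt : edge -> vertex
}.

Section realization.
Context (R : realType) (G : finite_multigraph).

(* A vertex contributes the one-point space {0}, an edge the interval [0, 1]. *)
Definition cell (c : vertex G + edge G) : set R :=
  if c is inl _ then [set 0] else `[0, 1].

Definition cell_space (c : vertex G + edge G) : topologicalType := cell c.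

Definition cells := {c : vertex G + edge G & cell_space c}.

(* A point of an open edge is kept; an end (e, 0) or (e, 1) is sent to the
   vertex to which it is attached.  Two points of the disjoint union of the
   cells are identified iff they have the same image under this map, which is
   the equivalence relation generated by the attaching maps. *)
Definition attach (p : cells) : vertex G + (edge G * R) :=
  match projT1 p with
  | inl v => inl v
  | inr e => let t := set_val (projT2 p) in
      if t == 0 then inl (edge_src e)
      else if t == 1 then inl (edge_tgt e)
      else inr (e, t)
  end.

Definition glue (p q : cells) : bool := attach p == attach q.

Lemma glue_refl : reflexive glue.
Proof. by move=> p; exact: eqxx. Qed.

Lemma glue_sym : symmetric glue.
Proof. by move=> p q; exact: eq_sym. Qed.

Lemma glue_trans : transitive glue.
Proof. by move=> q p r /eqP pq /eqP qr; apply/eqP; rewrite pq. Qed.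

Definition glue_rel := EquivRel glue glue_refl glue_sym glue_trans.

Definition realization := {eq_quot glue_rel}.

HB.instance Definition _ :=
  Topological.copy realization (quotient_topology realization).
HB.instance Definition _ := Quotient.on realization.

End realization.

Arguments cell R {G} c.
Arguments cell_space R {G} c.

Definition is_finite_graph (R : realType) (W : topologicalType) : Prop :=
  exists G : finite_multigraph, homeomorphic W (realization R G).

(* Main.v *)
(** The quotient map [q] from [X] onto the Reeb space [W] has connected fibres, so
    taking preimages matches connected open subsets of [W] with connected open
    saturated subsets of [X]; and [f] induces a map [g] from [W] to the reals
    which is light: no connected set with two points lies in a fibre of [g].
    If [W] is a graph, the open stars of its points pull back to star-like sets.

    Conversely, let [V] be a connected open subset of [W] which each of its
    points cuts into exactly two pieces.  Of any three points of [V], one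
    separates the other two.  Otherwise let [U x] be the piece at [x] containing
    at most one of the three.  The sets [U x] are nested or disjoint, so those
    whose root [x] lies in no other [U y] are disjoint, hence countably many;
    sending each point to the root above it is a retraction of [V] onto a
    countable connected set, which lightness shrinks to a point [x], and this
    leaves no room for the other piece at [x].  So [V] is linearly ordered.
    Summing, with weights [2^-n], the oscillations of [g] between the [n]-th
    point of a dense sequence and a variable point gives an increasing
    homeomorphism of [V] onto an open interval.

    Each end of an arm of a star either converges to the centre or stays away
    from it, so compactness covers [W] by finitely many points and finitely many
    open arcs with closed arcs as closures.  Removing these points and the ends
    of these arcs leaves finitely many components, all of them open arcs with
    ends among the removed points: these are the edges. *)

Require Import Defs.
From mathcomp Require Import all_boot all_order all_algebra finmap.
From mathcomp Require Import generic_quotient.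
From mathcomp Require Import all_classical all_reals all_analysis.
From mathcomp Require Import lra.
Import Order.TTheory GRing.Theory Num.Theory.
Import numFieldNormedType.Exports.

Set Implicit Arguments.
Unset Strict Implicit.
Unset Printing Implicit Defensive.

Local Open Scope classical_set_scope.
Local Open Scope ring_scope.
Local Open Scope quotient_scope.

Lemma disjoint_notin (T : Type) (A B : set T) :
  A `&` B = set0 -> forall x, A x -> ~ B x.
Proof. by move=> AB x Ax Bx; have : set0 x by rewrite -AB. Qed.

(** * Connected sets and their pieces *)

Section topology.
Context {T : topologicalType}.
Implicit Types A B C U V : set T.

Lemma open_from_nbhs A : (forall x, A x -> exists2 U, open U /\ U x & U `<=` A) -> open A.
Proof.
move=> H; rewrite openE => x /H[U [oU Ux] UA].
by apply: filterS UA _; exact: open_nbhs_nbhs.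
Qed.

Lemma openD_closed A C : open A -> closed C -> open (A `\` C).
Proof. by move=> oA cC; rewrite setDE; apply: openI => //; exact: closed_openC. Qed.

Lemma closedD_open A C : closed A -> open C -> closed (A `\` C).
Proof. by move=> oA cC; rewrite setDE; apply: closedI => //; exact: open_closedC. Qed.

(** The trace of [U] on [C] is also the trace of the complement of [V], hence relatively clopen.
    Open and closed pairs are handled together because [reeb_preim_connected] needs both. *)
Lemma connected_cover C U V : connected C ->
  open U /\ open V \/ closed U /\ closed V ->
  C `<=` U `|` V -> (forall x, C x -> U x -> ~ V x) -> C `&` U !=set0 ->
  C `<=` U.
Proof.
move=> cC UV CUV dUV CU; suff -> : C = C `&` U by move=> x [].
have E : C `&` U = C `&` ~` V.
  apply/seteqP; split=> x [Cx]; first by move=> Ux; split=> //; exact: dUV.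
  by move=> nVx; split => //; case: (CUV x Cx).
case: UV => -[U' V']; apply/esym/cC => //.
- by exists U.
- by exists (~` V); [exact: open_closedC|].
- by exists (~` V); [exact: closed_openC|].
- by exists U.
Qed.

Lemma connected_open_cover C U V : connected C -> open U -> open V ->
  C `<=` U `|` V -> (forall x, C x -> U x -> ~ V x) -> C `&` U !=set0 ->
  C `<=` U.
Proof. by move=> cC oU oV; apply: connected_cover => //; left. Qed.

(** When [A] is open (or closed), its relatively clopen parts are open (or closed) in [T].
    Separations can then be tested with sets of the ambient space, which a quotient map can
    transport. *)
Lemma connected_intro A : open A \/ closed A ->
  (forall U V, open U /\ open V \/ closed U /\ closed V -> A = U `|` V ->
    U `&` V = set0 -> U !=set0 -> V = set0) -> connected A.
Proof.
move=> ocA H B B0 [C oC BC] [D cD BD].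
have BA : B `<=` A by rewrite BC => x [].
have EC : A `\` B = A `\` C by rewrite BC setDIr setDv set0U.
have ED : A `\` B = A `\` D by rewrite BD setDIr setDv set0U.
have : open B /\ open (A `\` B) \/ closed B /\ closed (A `\` B).
  case: ocA => hA; [left|right]; split.
  - by rewrite BC; exact: openI.
  - by rewrite ED; exact: openD_closed.
  - by rewrite BD; exact: closedI.
  - by rewrite EC; exact: closedD_open.
move/H; rewrite setDUK// setDIK => /(_ erefl erefl B0) AB.
apply/seteqP; split=> // x Ax; apply: contrapT => nB.
by have : set0 x by rewrite -AB.
Qed.

Lemma connected_in_component C S x y : connected C -> C `<=` S ->
  C x -> C y -> connected_component S x y.
Proof. by move=> cC CS Cx Cy; exists C. Qed.

Lemma open_component A x : locally_connected T -> open A ->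
  open (connected_component A x).
Proof.
move=> lc oA; apply: open_from_nbhs => y Axy.
have [|V [oV cV Vy VA]] := lc y A.
  by apply: open_nbhs_nbhs; split => //; exact: connected_component_sub Axy.
exists V => // z Vz; apply: connected_component_trans Axy _.
by exists V.
Qed.

Lemma connected_between A C : connected A -> A `<=` C -> C `<=` closure A ->
  connected C.
Proof.
move=> cA AC CA U U0 [W oW UW] [D cD UD].
have AU : A `<=` U.
  apply/setIidPl/cA.
  - case: U0 => x Ux; have : (C `&` W) x by rewrite -UW.
    move=> [Cx Wx]; have [] := CA x Cx W; first exact: open_nbhs_nbhs.
    by move=> y [Ay Wy]; exists y; split=> //; rewrite UW; split=> //; exact: AC.
  - exists W => //; rewrite UW setIA (_ : A `&` C = A)//; exact/setIidPl.
  - exists D => //; rewrite UD setIA (_ : A `&` C = A)//; exact/setIidPl.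
apply/seteqP; split; first by rewrite UW => x [].
move=> x Cx; rewrite UD; split => //; apply: cD.
by apply: closureS (CA _ Cx) => y /AU; rewrite UD => -[].
Qed.

Lemma hausdorff_sep (x y : T) : hausdorff_space T -> x <> y ->
  exists U V, [/\ open U, open V, U x, V y & U `&` V = set0].
Proof.
rewrite open_hausdorff => H /eqP /H [[U V]] /= [Ux Vy] [oU oV /eqP UV].
by exists U, V; split => //; rewrite ?inE in Ux Vy *.
Qed.

(** For an open [S] in a locally connected space this amounts to having exactly two components, by
    [pieces_card] and [card_pieces]. *)
Definition pieces (S C1 C2 : set T) :=
  [/\ open C1 /\ open C2, connected C1 /\ connected C2,
      C1 !=set0 /\ C2 !=set0, C1 `&` C2 = set0 & S = C1 `|` C2].

Lemma piecesC S C1 C2 : pieces S C1 C2 -> pieces S C2 C1.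
Proof. by move=> [[? ?] [? ?] [? ?] ? ->]; split; rewrite // (setIC, setUC). Qed.

Lemma pieces_connected S C1 C2 C : pieces S C1 C2 -> connected C -> C `<=` S ->
  C `&` C1 !=set0 -> C `<=` C1.
Proof.
move=> [[op1 op2] _ _ d SE] cC CS CC1.
apply: (@connected_open_cover _ _ C2) => //; first by rewrite -SE.
by move=> x _; exact: disjoint_notin.
Qed.

Lemma pieces_component S C1 C2 x : pieces S C1 C2 -> C1 x ->
  connected_component S x = C1.
Proof.
move=> p C1x; apply/seteqP; split.
  apply: (pieces_connected p); first exact: component_connected.
    exact: connected_component_sub.
  exists x; split => //; apply: connected_component_refl.
  by case: p => _ _ _ _ ->; left.
case: p => _ [? _] _ _ ->.
by apply: connected_component_max => // z; left.
Qed.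

Lemma pieces_card S C1 C2 : pieces S C1 C2 -> (components S #= `I_2)%card.
Proof.
move=> p; have pC := piecesC p; case: (p) => _ _ [[a Ca] [b Cb]] d SE.
have -> : components S = [set C1; C2].
  apply/seteqP; split=> [_ [x + <-]|_ [|] ->].
  - rewrite SE => -[Cx|Cx]; rewrite -SE; [left|right].
      exact: pieces_component p Cx.
    exact: pieces_component pC Cx.
  - by exists a; [rewrite SE; left|exact: pieces_component p Ca].
  - by exists b; [rewrite SE; right|exact: pieces_component pC Cb].
have n12 : C1 != C2.
  by apply/eqP => E; move: d; rewrite -E setIid => E0; move: Ca; rewrite E0.
rewrite card_eq_sym; apply/card_set_bijP.
exists (fun n => if n is 0%N then C1 else C2); split.
- by move=> [|n] _; [left|right].
- move=> m n; rewrite !inE /=.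
  by case: m n => [|[|m]] [|[|n]] //= _ _ E; rewrite E eqxx in n12.
- by move=> _ [|] ->; [exists 0%N|exists 1%N].
Qed.

Lemma card_pieces S : locally_connected T -> open S ->
  (components S #= `I_2)%card -> exists C1 C2, pieces S C1 C2.
Proof.
move=> lc oS; rewrite card_eq_sym => /card_set_bijP[f [fS finj fsurj]].
have f0 : components S (f 0%N) by exact: fS.
have f1 : components S (f 1%N) by exact: fS.
have d : f 0%N `&` f 1%N = set0.
  apply/seteqP; split=> // z; case: f0 => x Sx E0; case: f1 => y Sy E1.
  rewrite -E0 -E1 => -[/same_connected_component zx /same_connected_component zy].
  have : 0%N = 1%N :> nat by apply: finj; rewrite ?inE// -E0 -E1 zx zy.
  by [].
exists (f 0%N), (f 1%N); split => //.
- by case: f0 => x Sx <-; case: f1 => y Sy <-; split; exact: open_component.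
- by case: f0 => x Sx <-; case: f1 => y Sy <-; split; exact: component_connected.
- case: f0 => x Sx <-; case: f1 => y Sy <-; split; [exists x|exists y]; exact: connected_component_refl.
- apply/seteqP; split=> z; last first.
    by case: f0 => x Sx <-; case: f1 => y Sy <-; case; exact: connected_component_sub.
  move=> Sz; have /fsurj[i] : components S (connected_component S z) by exists z.
  have zz : connected_component S z z by exact: connected_component_refl.
  by case: i => [|[|//]] _ E; [left|right]; rewrite E.
Qed.

End topology.

(** A connected set of reals with two points contains an interval of positive Lebesgue measure,
    whereas countable sets are null. *)
Lemma countable_connected (R : realType) (A : set R) : countable A ->
  connected A -> forall x y, A x -> A y -> x = y.
Proof.
move=> cA /connected_intervalP iA.
suff H x y : A x -> A y -> ~ x < y.
  by move=> x y Ax Ay; case: (ltgtP x y) => // xy; exfalso; [exact: (H x y)|exact: (H y x)].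
move=> Ax Ay xy.
have : countable (`[x, y]%classic : set R).
  apply: sub_countable cA; apply: subset_card_le => z /=; rewrite in_itv/=.
  exact: iA.
move/countable_lebesgue_measure0; rewrite lebesgue_measure_itv/= lte_fin xy.
by rewrite -EFinD => -[] /eqP; rewrite subr_eq0 => /eqP E; rewrite E ltxx in xy.
Qed.

(** * Cutting a connected open set at one of its points *)

Section pieces_theory.
Context {W : topologicalType} (V : set W).
Hypotheses (oV : open V) (cV : connected V).

(** If an open neighbourhood of [x] missed [A], its union with [B] would separate [V] from [A]. *)
Lemma piece_closure x A B : pieces (V `\` [set x]) A B -> V x -> closure A x.
Proof.
move=> [[oA oB] [cA cB] [[a Aa] _] dAB VE] Vx N Nx; apply: contrapT => AN.
have [M [oM Mx] MN] : exists2 M, open_nbhs x M & M `<=` N.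
  by move: Nx; rewrite nbhsE.
have /(_ x Vx) : V `<=` A.
  apply: (@connected_open_cover _ _ _ (B `|` M)) => //; first exact: openU.
  - move=> y Vy; have [->|yx] := pselect (y = x); first by right; right.
    have : (V `\` [set x]) y by [].
    by rewrite VE => -[]; [left|right; left].
  - move=> y _ Ay [By|My]; first exact: disjoint_notin dAB _ Ay By.
    by apply: AN; exists y; split => //; exact: MN.
  - exists a; split => //; have : (V `\` [set x]) a by rewrite VE; left.
    by case.
by move=> Ax; have : (V `\` [set x]) x by [rewrite VE; left]; case=> _; exact.
Qed.

Lemma piece_add x A B : pieces (V `\` [set x]) A B -> V x ->
  connected (A `|` [set x]).
Proof.
move=> p Vx; have cA : connected A by case: p => _ [].
apply: (connected_between cA); first exact: subsetUl.
by move=> y [/subset_closure//|->]; exact: piece_closure p Vx.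
Qed.

Lemma piece_sub x A B : pieces (V `\` [set x]) A B -> A `<=` V `\` [set x].
Proof. by move=> [_ _ _ _ ->]; left. Qed.

Lemma piece_cover x y A B : pieces (V `\` [set x]) A B -> V y -> x <> y ->
  A y \/ B y.
Proof.
move=> [_ _ _ _ E] Vy xy; have : (V `\` [set x]) y by split=> // /esym.
by rewrite E.
Qed.

Lemma piece_disj x A B : pieces (V `\` [set x]) A B -> forall z, A z -> ~ B z.
Proof. by case=> _ _ _ d _; exact: disjoint_notin. Qed.

(* [B] with [x] added is connected and misses [y]. *)
Lemma piece_nest x y A B C D : V x -> V y ->
  pieces (V `\` [set x]) A B -> pieces (V `\` [set y]) C D ->
  A y -> C x -> B `|` [set x] `<=` C.
Proof.
move=> Vx Vy px py Ay Cx.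
apply: (pieces_connected py); first exact: piece_add (piecesC px) Vx.
  move=> z [Bz|-> /=].
    have [Vz zx] := piece_sub (piecesC px) Bz.
    by split => // zy; apply: (piece_disj px Ay); rewrite -zy.
  by split => // E; have := piece_sub py Cx; rewrite E => -[_]; exact.
by exists x; split => //; right.
Qed.

End pieces_theory.

(** * Betweenness and order *)

Section laminar.
Context {R : realType} {W : topologicalType} (g : W -> R) (d : nat -> W).
Hypotheses (W_lc : locally_connected W) (W_T2 : hausdorff_space W).
Hypothesis g_cont : continuous g.
Hypothesis g_light : forall S, connected S ->
  (forall x y, S x -> S y -> g x = g y) -> forall x y, S x -> S y -> x = y.
Hypothesis d_dense : forall U, open U -> U !=set0 -> exists n, U (d n).
Variables (V : set W) (oV : open V) (cV : connected V).
Variables (L U : W -> set W).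
Hypothesis LU : forall x, V x -> pieces (V `\` [set x]) (L x) (U x).
Variables p q r : W.
(** A majority among three points; two sets that both hold a majority always meet. *)
Let two (S : set W) := (S p /\ S q) \/ (S p /\ S r) \/ (S q /\ S r).
Hypothesis L2 : forall x, V x -> two (L x).

Let two_meet S S' : two S -> two S' -> S `&` S' !=set0.
Proof.
rewrite /two => -[[? ?]|[[? ?]|[? ?]]] [[? ?]|[[? ?]|[? ?]]];
  by [exists p|exists q|exists r].
Qed.

(** The connected set [L x] with [x] added misses [y], which is in [U x], and meets [L y] by
    majority. So it lies in [L y], and taking complements reverses the inclusion. *)
Let nest x y : V x -> V y -> U x y -> U y `<=` U x.
Proof.
move=> Vx Vy Uxy z Uyz.
have pCx := piecesC (LU Vx); have pCy := piecesC (LU Vy).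
have Lyx : (L x `|` [set x]) `<=` L y.
  apply: (pieces_connected (LU Vy)); first exact: piece_add (LU Vx) Vx.
    move=> t [Lt|->] /=.
      have [Vt tx] := piece_sub (LU Vx) Lt.
      by split => // ty; apply: (piece_disj pCx Uxy); rewrite -ty.
    by split => // E; have [_] := piece_sub pCx Uxy; rewrite E; exact.
  have [t [Lxt Lyt]] := two_meet (L2 Vx) (L2 Vy).
  by exists t; split => //; left.
have [Vz zy] := piece_sub pCy Uyz.
have nLyz : ~ L y z by move=> /(piece_disj (LU Vy)); exact.
have [xz|zx] := pselect (x = z).
  by exfalso; apply: nLyz; apply: Lyx; right.
have [Lxz|//] := piece_cover (LU Vx) Vz zx.
by exfalso; apply: nLyz; apply: Lyx; left.
Qed.

(** If neither root lies in the set of the other, [piece_nest] puts [U x] inside [L y], so that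
    [U x] and [U y] are disjoint. *)
Let lam x y z : V x -> V y -> U x z -> U y z -> U x `<=` U y \/ U y `<=` U x.
Proof.
move=> Vx Vy Uxz Uyz.
have [->|xy] := pselect (x = y); first by left.
have [Lxy|Uxy] := piece_cover (LU Vx) Vy xy; last by right; exact: nest.
have yx : y <> x by move=> E; exact: xy.
have [Lyx|Uyx] := piece_cover (LU Vy) Vx yx; last by left; exact: nest.
exfalso; apply: (piece_disj (LU Vy) _ Uyz).
have : U x `|` [set x] `<=` L y by apply: piece_nest (LU Vx) (LU Vy) _ _.
by apply; left.
Qed.

(* [K] consists of the roots of the maximal sets [U w], and [E v] is the union of
   the chain of those containing [v]; its frontier is a single point of [K]. *)
Let K := [set k | V k /\ forall w, V w -> ~ U w k].
Let E v := \bigcup_(w in [set w | V w /\ U w v]) U w.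

Let U_open w : V w -> open (U w).
Proof. by move=> /LU[[]]. Qed.

Let E_open v : open (E v).
Proof. by apply: bigcup_open => w [/U_open]. Qed.

Let E_refl v : V v -> ~ K v -> E v v.
Proof.
move=> Vv nK; apply: contrapT => nE; apply: nK; split => // w Vw Uwv.
by apply: nE; exists w.
Qed.

(** [E v] is the union of a chain, so two of its points already lie in one member. *)
Let E_pair v a b : E v a -> E v b ->
  exists w, [/\ V w, U w v, U w a & U w b].
Proof.
move=> [w [Vw Uwv] Uwa] [w' [Vw' Uwv'] Uwb].
by case: (lam Vw Vw' Uwv Uwv') => S; [exists w'|exists w]; split=> //; exact: S.
Qed.

(** By [E_pair] a majority in [E v] would lie in a single [U w], but the disjoint [L w] holds a
    majority already. *)
Let E_two v : ~ two (E v).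
Proof.
have H w : V w -> ~ two (U w).
  move=> Vw tU; have [z [Lz Uz]] := two_meet (L2 Vw) tU.
  exact: piece_disj (LU Vw) _ Lz Uz.
by case=> [[]|[[]|[]]] => /E_pair /[apply] -[w [Vw _ Ua Ub]]; apply: (H w Vw);
  [left|right; left|right; right].
Qed.

Let E_eq v z : E v z -> E z = E v.
Proof.
suff H a b w : V w -> U w a -> U w b -> E a `<=` E b.
  by move=> [w [Vw Uv] Uz]; apply/seteqP; split; exact: (H _ _ w).
move=> Vw Ua Ub t [w' [Vw' Ua'] Ut].
case: (lam Vw Vw' Ua Ua') => S; first by exists w' => //; split => //; exact: S.
by exists w => //; exact: S.
Qed.

(** If [k] were in some [U w], this open set would meet a member of the chain of [v] and be
    comparable with it; either inclusion puts [k] in [E v]. *)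
Let E_bdK v k : closure (E v) k -> V k -> ~ E v k -> K k.
Proof.
move=> cl Vk nE; split => // w Vw Uwk.
have [|t [[w' [Vw' Uv] Ut] Uwt]] := cl (U w).
  by apply: open_nbhs_nbhs; split => //; exact: U_open.
case: (lam Vw Vw' Uwt Ut) => S; apply: nE.
  by exists w' => //; exact: S.
by exists w => //; split => //; exact: S.
Qed.

Let E_exit v C : connected C -> C `&` E v !=set0 -> ~ C `<=` E v ->
  exists2 k, C k & closure (E v) k /\ ~ E v k.
Proof.
move=> cC CE nC; apply: contrapT => H; apply: nC.
apply: (@connected_open_cover _ _ _ (~` closure (E v))) => //.
- exact/closed_openC/closed_closure.
- move=> y Cy; have [|] := pselect (E v y); [by left|move=> nE; right => cl].
  by apply: H; exists y.
- by move=> y _ Ey nc; apply: nc; exact: subset_closure.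
Qed.

(** Small connected neighbourhoods of [k] and [k'] both meet a single [U w] of the chain and both
    leave it. Each must then contain the root [w], although they are disjoint. *)
Let E_unique v k k' : V k -> V k' -> closure (E v) k -> ~ E v k ->
  closure (E v) k' -> ~ E v k' -> k = k'.
Proof.
move=> Vk Vk' ck nk ck' nk'; apply: contrapT => kk'.
have [N [N' [oN oN' Nk Nk' dN]]] := hausdorff_sep W_T2 kk'.
have nb M x : open M -> V x -> M x -> nbhs x (M `&` V).
  by move=> oM Vx Mx; apply: open_nbhs_nbhs; split => //; exact: openI.
have [G [oG cG Gk GN]] := W_lc (nb _ _ oN Vk Nk).
have [G' [oG' cG' Gk' GN']] := W_lc (nb _ _ oN' Vk' Nk').
have [a [Ea Ga]] := ck G (open_nbhs_nbhs (conj oG Gk)).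
have [b [Eb Gb]] := ck' G' (open_nbhs_nbhs (conj oG' Gk')).
have [w [Vw Uv Ua Ub]] := E_pair Ea Eb.
have H M x y : connected M -> M `<=` V -> M x -> ~ E v x -> M y -> U w y -> M w.
  move=> cM MV Mx nE My Uy; apply: contrapT => nMw; apply: nE.
  exists w => //; have pC := piecesC (LU Vw).
  apply: (pieces_connected pC) (Mx) => //; last by exists y.
  by move=> t Mt; split; [exact: MV|move=> E'; apply: nMw; rewrite -E'].
have Gw : G w by apply: (H G k a) => // t /GN[].
have Gw' : G' w by apply: (H G' k' b) => // t /GN'[].
by apply: (disjoint_notin dN (x := w)); [case: (GN _ Gw)|case: (GN' _ Gw')].
Qed.

(** Off [K] the value is a frontier point of [E v]. There is one because [V] is connected and holds
    a majority, which [E v] does not. *)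
Let retract : exists rho : W -> W, forall v, V v ->
  [/\ K (rho v), K v -> rho v = v & ~ K v -> closure (E v) (rho v)].
Proof.
suff /choice[rho H] : forall v, exists k, V v ->
    [/\ K k, K v -> k = v & ~ K v -> closure (E v) k] by exists rho.
move=> v; have [Vv|nV] := pselect (V v); last by exists v.
have [Kv|nK] := pselect (K v); first by exists v.
have [||k Vk [ck nk]] := @E_exit v V cV.
- by exists v; split => //; exact: E_refl.
- move=> VE; apply: (@E_two v).
  by case: (L2 Vv) => [[]|[[]|[]]] => /(piece_sub (LU Vv))[/VE a _]
    /(piece_sub (LU Vv))[/VE b _]; [left|right; left|right; right].
- by exists k; split => //; exact: E_bdK ck Vk nk.
Qed.

Lemma laminar_false : V !=set0 -> False.
Proof.
move=> [v0 Vv0]; have [rho rhoP] := retract.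
have KV k : K k -> V k by case.
(* Since [E v] contains no point of [K], a connected [G] that meets [K] must cross the frontier of
   [E v], which is [rho v]. This gives continuity at the points of [K]. *)
have rho_in G k v : connected G -> G `<=` V -> K k -> G k -> G v -> G (rho v).
  move=> cG GV Kk Gk Gv; have [Kr rK rnK] := rhoP v (GV _ Gv).
  have [Kv|nK] := pselect (K v); first by rewrite rK.
  have nEK k' : K k' -> ~ E v k'.
    by move=> [Vk' H] [w [Vw _] Uwk]; exact: (H w).
  have [||k' Gk' [ck' nk']] := @E_exit v G cG.
  - by exists v; split => //; apply: E_refl => //; exact: GV.
  - by move=> /(_ _ Gk); exact: nEK.
  - rewrite (_ : rho v = k')//.
    apply: (@E_unique v) => //; [exact: KV|exact: GV|exact: rnK|exact: nEK].
(* Off [K] the map is locally constant. *)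
have rho_E v z : V v -> ~ K v -> E v z -> rho z = rho v.
  move=> Vv nK Ez; have Vz : V z.
    by case: Ez => w [Vw _] /(piece_sub (piecesC (LU Vw)))[].
  have nKz : ~ K z by move=> [_ H]; case: Ez => w [Vw _]; exact: H.
  have [Kr _ /(_ nK) rv] := rhoP v Vv; have [Kz _ /(_ nKz) rz] := rhoP z Vz.
  have nEK k : K k -> ~ E v k.
    by move=> [Vk' H] [w [Vw _] Uwk]; exact: (H w).
  rewrite (E_eq Ez) in rz.
  by apply: (@E_unique v) => //; [exact: KV|exact: KV|exact: nEK|exact: nEK].
have rho_cont : {within V, continuous rho}.
  apply: continuous_in_subspaceT => v; rewrite inE => Vv.
  have [Kv|nK] := pselect (K v); last first.
    move=> M Mv; change (nbhs v (rho @^-1` M)); apply: (@filterS _ _ _ (E v)).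
      by move=> z /(rho_E _ _ Vv nK) E'; rewrite /preimage /= E'; exact: nbhs_singleton.
    by apply: open_nbhs_nbhs; split => //; exact: E_refl.
  have [_ /(_ Kv) rv _] := rhoP v Vv.
  move=> M; rewrite rv => Mv.
  have [|G [oG cG Gv GM]] := W_lc (_ : nbhs v (M `&` V)).
    by apply: filterI => //; apply: open_nbhs_nbhs.
  change (nbhs v (rho @^-1` M)); apply: (@filterS _ _ _ G); last by apply: open_nbhs_nbhs.
  move=> z Gz; have [|//] := GM (rho z).
  by apply: (rho_in G v) => // t /GM[].
have cr : connected (rho @` V) by exact: connected_continuous_connected.
(* The sets [U k], for [k] in [K], are non-empty, open and pairwise disjoint, so each is marked by
   its own term of the dense sequence. *)
have cntK : countable K.
  have /choice[n nP] : forall k, exists n, K k -> U k (d n).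
    move=> k; have [Kk|] := pselect (K k); last by exists 0%N.
    have [n dn] := d_dense (U_open (KV _ Kk)) (let: And5 _ _ (conj _ x) _ _ := LU (KV _ Kk) in x).
    by exists n.
  apply/countable_injP; exists n => k k'; rewrite !inE => Kk Kk' E'.
  have Uk := nP _ Kk; have Uk' := nP _ Kk'; rewrite E' in Uk.
  apply: contrapT => kk'.
  have [Vk nk] := Kk; have [Vk' nk'] := Kk'.
  have [Lk|] := piece_cover (LU Vk) Vk' kk'; last exact: nk'.
  have [|Lk'|] := piece_cover (LU Vk') Vk (_ : k' <> k); [by move=> /esym| |exact: nk].
  have /(_ _ (or_introl Uk)) : U k `|` [set k] `<=` L k'.
    exact: piece_nest (LU Vk) (LU Vk') _ _.
  by move=> Lk2; apply: (piece_disj (LU Vk') Lk2).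
have cgr : connected (g @` (rho @` V)).
  apply: connected_continuous_connected => //.
  by apply: continuous_subspaceT.
have ctgr : countable (g @` (rho @` V)).
  apply: sub_countable (card_image_le _ _) _.
  apply: sub_countable cntK; apply: subset_card_le => _ [v Vv <-].
  by case: (rhoP v Vv).
have rho1 : forall x y, V x -> V y -> rho x = rho y.
  move=> x y Vx Vy; apply: (g_light cr); [|by exists x|by exists y].
  move=> a b Ha Hb; apply: (countable_connected ctgr cgr); [by exists a|by exists b].
pose k := rho v0.
have Kk : K k by case: (rhoP v0 Vv0).
have Vk := KV _ Kk.
have K1 z : K z -> z = k.
  move=> Kz; have [_ /(_ Kz) <- _] := rhoP z (KV _ Kz).
  by apply: rho1 => //; exact: KV.
have [_ [cL _] [[a La] _] _ _] := LU Vk.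
have nKL z : L k z -> ~ K z.
  by move=> /(piece_sub (LU Vk))[Vz zk] /K1.
have Va : V a by have [] := piece_sub (LU Vk) La.
apply: (@E_two a).
(* As [k] is the only point of [K], the connected set [L k] cannot cross the frontier of [E a]. So
   [E a] would hold the majority that [L k] holds. *)
have LE : L k `<=` E a.
  apply: contrapT => /(E_exit cL)[].
    by exists a; split => //; apply: E_refl => //; exact: nKL.
  move=> z Lz [cz nz]; apply: (nKL z Lz); apply: E_bdK cz _ nz.
  by have [] := piece_sub (LU Vk) Lz.
by case: (L2 Vk) => [[]|[[]|[]]] => /LE x /LE y; [left|right; left|right; right].
Qed.

End laminar.

(** * Coherent choice of a side at every point *)

Section orientation.
Context {R : realType} {W : topologicalType} (g : W -> R) (d : nat -> W).
Hypotheses (W_lc : locally_connected W) (W_T2 : hausdorff_space W).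
Hypothesis g_cont : continuous g.
Hypothesis g_light : forall S, connected S ->
  (forall x y, S x -> S y -> g x = g y) -> forall x y, S x -> S y -> x = y.
Hypothesis d_dense : forall U, open U -> U !=set0 -> exists n, U (d n).
Variables (V : set W) (oV : open V) (cV : connected V).
Variables A B : W -> set W.
Hypothesis AB : forall x, V x -> pieces (V `\` [set x]) (A x) (B x).

Let a x y := `[< A x y >].

Let aP x y : V x -> V y -> x <> y -> B x y <-> ~~ a x y.
Proof.
move=> Vx Vy xy; split=> [By|/asboolP nA].
  by apply/asboolP => /(piece_disj (AB Vx)); exact.
by have [] := piece_cover (AB Vx) Vy xy.
Qed.

(** If none of the three points separated the other two, one piece at every point of [V] would hold
    two of them, and naming it [L x] would contradict [laminar_false]. *)
Let one_separates p q r : V p -> V q -> V r -> p <> q -> p <> r -> q <> r ->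
  a p q = a p r -> a q p = a q r -> a r p = a r q -> False.
Proof.
move=> Vp Vq Vr pq pr qr ap aq ar.
pose two (S : set W) := (S p /\ S q) \/ (S p /\ S r) \/ (S q /\ S r).
pose L x := if `[< two (A x) >] then A x else B x.
pose U x := if `[< two (A x) >] then B x else A x.
have LU x : V x -> pieces (V `\` [set x]) (L x) (U x).
  rewrite /L /U; case: ifP => _ Vx; first exact: AB.
  exact/piecesC/AB.
suff L2 x : V x -> two (L x).
  exact: (laminar_false W_lc W_T2 g_cont g_light d_dense oV cV LU L2 (ex_intro _ p Vp)).
move=> Vx; rewrite /L; case: asboolP => //.
have H y z : V y -> V z -> x <> y -> x <> z -> a x y = a x z ->
    (A x y /\ A x z) \/ (B x y /\ B x z).
  move=> Vy Vz xy xz E; have [Ay|nA] := boolP (a x y).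
    by left; split; apply/asboolP; rewrite -/(a _ _) -?E.
  by right; split; apply/aP => //; rewrite -E.
rewrite /two => n2.
have [xp|xp] := pselect (x = p).
  by subst x; have [[]|[]] := H q r Vq Vr pq pr ap; tauto.
have [xq|xq] := pselect (x = q).
  by subst x; have [[]|[]] := H p r Vp Vr xp qr aq; tauto.
have [xr|xr] := pselect (x = r).
  by subst x; have [[]|[]] := H p q Vp Vq xp xq ar; tauto.
have := piece_cover (AB Vx) Vp xp; have := piece_cover (AB Vx) Vq xq.
have := piece_cover (AB Vx) Vr xr; tauto.
Qed.

Let side_const C x y z : V x -> connected C -> C `<=` V `\` [set x] ->
  C y -> C z -> a x y = a x z.
Proof.
move=> Vx cC CV.
suff H u v : C u -> C v -> A x u -> A x v.
  by move=> Cy Cz; apply/asboolP/asboolP; exact: H.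
move=> Cu Cv Au; apply: (pieces_connected (AB Vx) cC CV) (Cv).
by exists u.
Qed.

(** At most one of three points separates the other two: if [q] does, the piece containing [p], with
    [q] added, is connected and misses [r]. *)
Let sep_same p q r : V p -> V q -> V r -> p <> q -> p <> r -> q <> r ->
  a q p != a q r -> a r p = a r q.
Proof.
move=> Vp Vq Vr pq pr qr n.
have qp : q <> p by move=> /esym.
have [C [D [pc Cp Dr]]] : exists C D, [/\ pieces (V `\` [set q]) C D, C p & D r].
  have := aP Vq Vp qp; have := aP Vq Vr qr; move: n.
  have [Ap|nAp] := boolP (a q p); have [Ar|nAr] := boolP (a q r) => // _ H1 H2.
    by exists (A q), (B q); split; [exact: AB|exact/asboolP|exact/H1].
  by exists (B q), (A q); split; [exact/piecesC/AB|exact/H2|exact/asboolP].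
apply: (@side_const (C `|` [set q])) => //; last 2 first.
- by left.
- by right.
- exact: piece_add pc Vq.
move=> z [Cz|-> //]; split; first by have [] := piece_sub pc Cz.
by move=> E; apply: (piece_disj pc Cz); rewrite E.
Qed.

Lemma exists_orientation : V !=set0 -> exists L R0 : W -> set W,
  (forall x, V x -> pieces (V `\` [set x]) (L x) (R0 x)) /\
  (forall x y, V x -> V y -> x <> y -> R0 x y <-> ~ R0 y x).
Proof.
move=> [p Vp].
(* [e x] swaps the pieces at [x] so as to agree with those at [p].  Two further
   points then agree because an odd number of three points (namely one)
   separates the other two. *)
pose e x := if x == p then false else ~~ (a x p (+) a p x).
pose L x := if e x then A x else B x.
pose R0 x := if e x then B x else A x.
exists L, R0; split.
  move=> x Vx; rewrite /L /R0; case: ifP => _; first exact: AB.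
  exact/piecesC/AB.
have RP x y : V x -> V y -> x <> y -> R0 x y <-> a x y (+) e x.
  move=> Vx Vy xy; rewrite /R0; case: (e x) => /=.
    by rewrite addbT; exact: aP.
  by rewrite addbF; split => /asboolP.
suff H x y : V x -> V y -> x <> y -> (a x y (+) e x) (+) (a y x (+) e y).
  move=> x y Vx Vy xy; have yx : y <> x by move=> /esym.
  have Hxy := H x y Vx Vy xy; split.
    by move=> /(RP _ _ Vx Vy xy) h1 /(RP _ _ Vy Vx yx) h2; move: Hxy; rewrite h1 h2.
  move=> n; apply/RP => //; have : ~~ (a y x (+) e y) by apply/negP => /(RP _ _ Vy Vx yx).
  by move: Hxy; case: (a y x (+) e y); case: (a x y (+) e x).
move=> Vx Vy xy; rewrite /e; case: eqP => xp.
  subst x; case: eqP => [yp|_]; first by case: xy.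
  by case: (a p y); case: (a y p).
case: eqP => [yp|yp].
  by subst y; case: (a p x); case: (a x p).
have px : p <> x by move=> /esym.
have py : p <> y by move=> /esym.
have yx : y <> x by move=> /esym.
have := one_separates Vp Vx Vy px py xy.
have := sep_same Vx Vp Vy xp xy py; have := sep_same Vy Vp Vx yp yx px.
have := sep_same Vp Vx Vy px py xy; have := sep_same Vy Vx Vp yx yp xp.
have := sep_same Vp Vy Vx py px yx; have := sep_same Vx Vy Vp xy xp yp.
(* The six booleans tell on which sides the three points lie. The seven facts rule out every
   assignment with none or more than one separating point, and in the others the parity is right. *)
case: (a p x); case: (a p y); case: (a x p); case: (a x y);
  case: (a y p); case: (a y x) => h1 h2 h3 h4 h5 h6 h7;
  first [by [] | by have := h1 isT | by have := h2 isT | by have := h3 isT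
    | by have := h4 isT | by have := h5 isT | by have := h6 isT
    | by have := h7 erefl erefl erefl].
Qed.

End orientation.

(** * Parametrization of cylinders *)

Section open_arc_def.
Context {R : realType} {W : topologicalType}.

(** The last clause makes [k] an open map on the interval, hence a homeomorphism onto [V]. Nothing
    is asked of [k] outside []a, b[]. *)
Definition open_arc (k : R -> W) (a b : R) (V : set W) :=
  [/\ a < b, V = k @` `]a, b[, {in `]a, b[, continuous k},
      {in `]a, b[ &, injective k} &
      forall s t, a <= s -> s < t -> t <= b -> open (k @` `]s, t[)].

End open_arc_def.

Lemma geometric_sum_le2 (R : realType) N : \sum_(i < N) (2^-1 : R) ^+ i <= 2.
Proof.
suff -> : \sum_(i < N) (2^-1 : R) ^+ i = 2 - 2 * 2^-1 ^+ N.
  by rewrite gerBl mulr_ge0// exprn_ge0// invr_ge0.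
elim: N => [|N IH]; first by rewrite big_ord0 expr0 mulr1 subrr.
rewrite big_ord_recr/= IH exprS.
by set z := 2^-1 ^+ N; lra.
Qed.

Section parametrization.
Context {R : realType} {W : topologicalType} (g : W -> R) (d : nat -> W).
Hypotheses (W_lc : locally_connected W).
Hypothesis g_cont : continuous g.
Hypothesis g_light : forall S, connected S ->
  (forall x y, S x -> S y -> g x = g y) -> forall x y, S x -> S y -> x = y.
Hypothesis d_dense : forall U, open U -> U !=set0 -> exists n, U (d n).
Variables (M : R) (g_bd : forall w, `|g w| <= M).
Variables (V : set W) (oV : open V) (cV : connected V) (V0 : V !=set0).
Variables L U : W -> set W.
Hypothesis LU : forall x, V x -> pieces (V `\` [set x]) (L x) (U x).
Hypothesis coh : forall x y, V x -> V y -> x <> y -> U x y <-> ~ U y x.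

Let UV x y : V x -> U x y -> V y.
Proof. by move=> Vx /(piece_sub (piecesC (LU Vx)))[]. Qed.

Let LV x y : V x -> L x y -> V y.
Proof. by move=> Vx /(piece_sub (LU Vx))[]. Qed.

Let U_neq x y : V x -> U x y -> x <> y.
Proof. by move=> Vx /(piece_sub (piecesC (LU Vx)))[_ n] E; exact: n. Qed.

Let U_irr x : V x -> ~ U x x.
Proof. by move=> Vx /(U_neq Vx). Qed.

Let U_asym x y : V x -> U x y -> ~ U y x.
Proof.
move=> Vx Uxy; have Vy := UV Vx Uxy.
exact: (coh Vx Vy (U_neq Vx Uxy)).1.
Qed.

Let L_U x y : V x -> V y -> L x y <-> U y x.
Proof.
move=> Vx Vy; split.
  move=> Lxy; have yx : y <> x by move=> E; case: (piece_sub (LU Vx) Lxy).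
  by apply: (coh Vy Vx yx).2; exact: piece_disj (LU Vx) _ Lxy.
move=> Uyx; have yx := U_neq Vy Uyx.
have xy : x <> y by move=> /esym.
by case: (piece_cover (LU Vx) Vy xy) => // /(U_asym Vx).
Qed.

Let U_total x y : V x -> V y -> x = y \/ U x y \/ U y x.
Proof.
move=> Vx Vy; have [->|xy] := pselect (x = y); first by left.
by right; case: (piece_cover (LU Vx) Vy xy) => [/(L_U Vx Vy)|]; [right|left].
Qed.

Let U_trans x y z : V x -> U x y -> U y z -> U x z.
Proof.
move=> Vx Uxy Uyz; have Vy := UV Vx Uxy.
have /(_ z) : U y `|` [set y] `<=` U x; last by apply; left.
apply: (piece_nest cV Vy Vx (LU Vy) (piecesC (LU Vx))) => //.
exact/L_U.
Qed.

(** A connected subset of [V] that misses [z] stays on one side of [z]. *)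
Let convex G x y z : connected G -> G `<=` V -> G x -> G y -> U x z -> U z y ->
  G z.
Proof.
move=> cG GV Gx Gy Uxz Uzy; apply: contrapT => nGz.
have Vx := GV _ Gx; have Vz := UV Vx Uxz.
have : G `<=` U z.
  apply: (pieces_connected (piecesC (LU Vz)) cG); last by exists y.
  by move=> t Gt; split; [exact: GV|move=> /= E; rewrite -E in nGz].
by move=> /(_ _ Gx); exact: U_asym Uxz.
Qed.

(* [U x y] reads [x < y]; [I c x] is the segment from [c] to [x], reduced to [c]
   when [x <= c]. *)
Let I c x y := V y /\ (y = c \/ (U c y /\ (y = x \/ U y x))).
Let D c x := [set `|g y - g c| | y in I c x].
(** The largest deviation of [g] from [g c] on the segment. Unlike [g] itself, it is monotone in
    [x]; it is 0 up to [c]. *)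
Let G c x := sup (D c x).

Let D_bd c x : ubound (D c x) (M + M).
Proof.
move=> _ [y _ <-]; apply: le_trans (ler_normB _ _) _.
by apply: lerD; exact: g_bd.
Qed.

Let I_refl c x : V c -> I c x c.
Proof. by split => //; left. Qed.

Let D_ub c x y : I c x y -> `|g y - g c| <= G c x.
Proof. by move=> Iy; apply: ub_le_sup; [exists (M + M); exact: D_bd|exists y]. Qed.

Let G_le c x e : V c -> (forall y, I c x y -> `|g y - g c| <= e) -> G c x <= e.
Proof.
move=> Vc H; apply: ge_sup; first by exists `|g c - g c|; exists c => //; exact: I_refl.
by move=> _ [y Iy <-]; exact: H.
Qed.

Let G_ge0 c x : V c -> 0 <= G c x.
Proof. by move=> Vc; apply: le_trans (D_ub (I_refl x Vc)); exact: normr_ge0. Qed.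

Let G_le2M c x : V c -> G c x <= M + M.
Proof. by move=> Vc; apply: G_le => // y Iy; apply: (@D_bd c x); exists y. Qed.

Let G_mono c x y : V c -> V x -> U x y -> G c x <= G c y.
Proof.
move=> Vc Vx Uxy; apply: G_le => // z [Vz zI]; apply: D_ub; split => //.
case: zI => [->|[Ucz zx]]; [by left|right; split=> //; right].
by case: zx => [->//|Uzx]; exact: U_trans Uzx Uxy.
Qed.

(** The points of the segment up to [y] that lie beyond [x] are in [S] by convexity, so they raise
    the deviation by at most [e]. If [c] lies beyond [x], it is in [S] as well. *)
Let G_osc c S e x y : V c -> connected S -> S `<=` V ->
  (forall a b, S a -> S b -> `|g a - g b| <= e) -> 
  S x -> S y -> U x y -> G c y <= G c x + e.
Proof.
move=> Vc cS SV Se Sx Sy Uxy; have Vx := SV _ Sx; have Vy := SV _ Sy.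
have e0 : 0 <= e by apply: le_trans (Se _ _ Sx Sx).
apply: G_le => // z [Vz [->|[Ucz zy]]].
  by rewrite subrr normr0 addr_ge0// G_ge0.
have [Ixz|nIxz] := pselect (I c x z).
  by apply: le_trans (D_ub Ixz) _; rewrite lerDl.
have Uxz : U x z.
  case: (U_total Vx Vz) => [E|[//|Uzx]]; exfalso; apply: nIxz; split => //; right; split => //.
    by left.
  by right.
have Sz : S z by case: zy => [->//|Uzy]; exact: (convex cS SV Sx Sy).
case: (U_total Vc Vx) => [E|[Ucx|Uxc]].
- by rewrite E; apply: le_trans (Se _ _ Sz Sx) _; rewrite lerDr -E G_ge0.
- rewrite -(subrK (g x) (g z)) -addrA; apply: le_trans (ler_normD _ _) _.
  rewrite [leRHS]addrC; apply: lerD; first exact: Se.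
  by apply: D_ub; split => //; right; split => //; left.
- have Sc : S c.
    apply: (convex cS SV Sx Sy) => //.
    by case: zy => [<-//|]; exact: U_trans.
  by apply: le_trans (Se _ _ Sz Sc) _; rewrite lerDr G_ge0.
Qed.

(** Otherwise the open sets [U x] and [L y] would separate [V]. *)
Let dense_order x y : V x -> U x y -> exists z, U x z /\ U z y.
Proof.
move=> Vx Uxy; have Vy := UV Vx Uxy.
have [[oLx oUx] _ _ _ _] := LU Vx; have [[oLy oUy] _ _ _ _] := LU Vy.
apply: contrapT => H.
have /(_ _ Vx) : V `<=` U x.
  apply: (@connected_open_cover _ _ _ (L y)) => //.
  - move=> z Vz; case: (U_total Vx Vz) => [<-|[|Uzx]]; [right|by left|right].
      exact/L_U.
    by apply/L_U => //; exact: U_trans Uzx Uxy.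
  - move=> z Vz Uxz Lyz; apply: H; exists z; split => //.
    exact/L_U.
  - by exists y.
exact: U_irr.
Qed.

(** For a dense point strictly between [x] and [y] the left side is at most 0. If the right side
    were too, [g] would be constant on an open segment, and lightness would produce an isolated
    point of the connected set [V]. *)
Let G_strict x y : V x -> U x y -> exists n, V (d n) /\ G (d n) x < G (d n) y.
Proof.
move=> Vx Uxy; have Vy := UV Vx Uxy.
have [[oLx oUx] _ _ _ _] := LU Vx; have [[oLy oUy] _ _ _ _] := LU Vy.
have [|n [Uxd Ldy]] := d_dense (openI oUx oLy).
  have [z [Uxz Uzy]] := dense_order Vx Uxy.
  by exists z; split => //; apply/L_U => //; exact: UV Uxz.
have Vd := UV Vx Uxd; have Udy := (L_U Vy Vd).1 Ldy.
exists n; split => //.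
apply: (@le_lt_trans _ _ 0).
  apply: G_le => // z [Vz [->|[Udz zx]]]; first by rewrite subrr normr0.
  exfalso; apply: (U_asym Vx Uxd); case: zx => [<-//|].
  exact: U_trans.
apply: contrapT => /negP; rewrite -leNgt => Gy.
have gc z : U (d n) z -> U z y -> g z = g (d n).
  move=> Udz Uzy; apply/eqP; rewrite -subr_eq0 -normr_le0.
  apply: le_trans Gy; apply: D_ub; split; first exact: UV Udz.
  by right; split => //; right.
have [z [Udz Uzy]] := dense_order Vd Udy.
have Vz := UV Vd Udz.
have [[_ oUd] _ _ _ _] := LU Vd.
have [S [oS cS Sz SS]] := W_lc (open_nbhs_nbhs (conj (openI oUd oLy) (conj Udz ((L_U Vy Vz).2 Uzy)))).
have S1 t : S t -> t = z.
  move=> St; apply: (g_light cS) => // a b /SS[Ua La] /SS[Ub Lb].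
  by rewrite !gc//; apply/(L_U Vy) => //; exact: UV Ua || exact: UV Ub.
have [z' [Uzz' _]] := dense_order Vz Uzy.
have /(_ _ (UV Vz Uzz')) : V `<=` S.
  apply: (@connected_open_cover _ _ _ (L z `|` U z)) => //.
  - by have [[? ?] _ _ _ _] := LU Vz; exact: openU.
  - move=> t Vt; have [zt|zt] := pselect (z = t); first by left; rewrite -zt.
    by right; exact: piece_cover (LU Vz) Vt zt.
  - move=> t _ /S1 -> [Lz|Uz]; first by have [_] := piece_sub (LU Vz) Lz; exact.
    exact: U_irr Uz.
  - by exists z.
by move=> /S1 E; apply: (U_irr Vz); rewrite -{2}E.
Qed.

(** Dense points outside [V] contribute 0. The summands are non-negative, so the supremum [h] of the
    partial sums below is the sum of the series. *)
Let c n x := if `[< V (d n) >] then G (d n) x else 0.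
Let s N x := \sum_(i < N) 2^-1 ^+ i * c i x.
Let T x := [set s N x | N in [set: nat]].
Let h x := sup (T x).

Let c_le x n : 0 <= c n x <= M + M.
Proof.
rewrite /c; case: asboolP => Vd; first by rewrite G_ge0// G_le2M.
by rewrite lexx addr_ge0// (le_trans (normr_ge0 _) (g_bd (d n))).
Qed.

Let w_ge0 n : 0 <= (2^-1 : R) ^+ n.
Proof. by rewrite exprn_ge0// invr_ge0. Qed.

Let s_shift N x y e : 0 <= e -> (forall n, c n y <= c n x + e) -> s N y <= s N x + e * 2.
Proof.
move=> e0 H; apply: (@le_trans _ _ (s N x + e * \sum_(i < N) 2^-1 ^+ i)).
  rewrite mulr_sumr -big_split/=; apply: ler_sum => i _.
  by rewrite (mulrC e) -mulrDr ler_wpM2l.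
by rewrite lerD2l ler_wpM2l// geometric_sum_le2.
Qed.

Let s_bd N x : s N x <= (M + M) * 2.
Proof.
have M0 : 0 <= M + M by case/andP: (c_le x 0%N) => h1 h2; exact: le_trans h1 h2.
rewrite /s; apply: (@le_trans _ _ (\sum_(i < N) (M + M) * 2^-1 ^+ i)).
  apply: ler_sum => i _; rewrite mulrC; apply: ler_wpM2r => //.
  by case/andP: (c_le x i).
by rewrite -mulr_sumr ler_wpM2l// geometric_sum_le2.
Qed.

Let T_bd x : has_ubound (T x).
Proof. by exists ((M + M) * 2) => _ [N _ <-]. Qed.

Let T_ub N x : s N x <= h x.
Proof. by apply: ub_le_sup; [exact: T_bd|exists N]. Qed.

Let h_le x e : (forall N, s N x <= e) -> h x <= e.
Proof.
move=> H; apply: ge_sup; first by exists (s 0 x); exists 0%N.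
by move=> _ [N _ <-].
Qed.

Let c_mono n x y : V x -> U x y -> c n x <= c n y.
Proof.
move=> Vx Uxy; rewrite /c; case: asboolP => Vd //.
exact: G_mono.
Qed.

Let s_homo x : {homo (fun N => s N x) : m n / (m <= n)%N >-> m <= n}.
Proof.
apply: homo_leq => // [y z t|N]; first exact: le_trans.
by rewrite /s big_ord_recr/= lerDl mulr_ge0//; case/andP: (c_le x N).
Qed.

Let h_strict x y : V x -> U x y -> h x < h y.
Proof.
move=> Vx Uxy; have [n [Vd Gn]] := G_strict Vx Uxy.
have cn : c n x < c n y by rewrite /c; case: asboolP.
pose e := 2^-1 ^+ n * (c n y - c n x).
have e0 : 0 < e by rewrite mulr_gt0// ?subr_gt0// exprn_gt0// invr_gt0.
apply: (@lt_le_trans _ _ (h x + e)); first by rewrite ltrDl.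
rewrite -lerBrDr; apply: h_le => N; rewrite lerBrDr.
(* The partial sum is lengthened so as to include the index [n], where the gain [e] occurs. *)
apply: (@le_trans _ _ (s (N + n.+1) x + e)); first by rewrite lerD2r s_homo// leq_addr.
apply: le_trans (T_ub (N + n.+1) y).
have nN : (n < N + n.+1)%N by rewrite addnS ltnS leq_addl.
rewrite /s (bigD1 (Ordinal nN))//= [leRHS](bigD1 (Ordinal nN))//=.
rewrite addrAC -mulrDr addrC (addrC (c n x)) subrK.
rewrite addrC lerD2l; apply: ler_sum => i _; apply: ler_wpM2l => //.
exact: c_mono.
Qed.

Let h_cont x : V x -> {for x, continuous h}.
Proof.
move=> Vx; apply/cvgrPdist_le => e e0.
(* A deviation of [e / 4] from [g x] gives [e / 2] between two points of [S], and the weights, of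
   sum at most 2, turn this into [e]. *)
have e8 : 0 < e / 4 by rewrite divr_gt0.
have /cvgrPdist_le/(_ _ e8) gx := @g_cont x.
have [S [oS cS Sx SS]] := W_lc (filterI (open_nbhs_nbhs (conj oV Vx)) gx).
have Se a b : S a -> S b -> `|g a - g b| <= e / 2.
  move=> /SS[_ /= ga] /SS[_ /= gb].
  rewrite -(subrK (g x) (g a)) -addrA; apply: le_trans (ler_normD _ _) _.
  by rewrite distrC; lra.
have SV : S `<=` V by move=> t /SS[].
have H a b : S a -> S b -> U a b -> h b <= h a + e.
  move=> Sa Sb Uab; apply: h_le => N.
  apply: (@le_trans _ _ (s N a + e / 2 * 2)); last by rewrite divfK// lerD2r.
  apply: s_shift => [|n]; first lra.
  rewrite /c; case: asboolP => Vd; last by lra.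
  exact: (G_osc Vd cS SV Se).
apply: (@filterS _ _ _ S); last by apply: open_nbhs_nbhs.
move=> y Sy /=; have Vy := SV _ Sy.
case: (U_total Vx Vy) => [->|[Uxy|Uyx]]; first by rewrite subrr normr0 ltW.
- have := h_strict Vx Uxy; have := H _ _ Sx Sy Uxy => h1 h2.
  by rewrite ler_norml; apply/andP; split; lra.
- have := h_strict Vy Uyx; have := H _ _ Sy Sx Uyx => h1 h2.
  by rewrite ler_norml; apply/andP; split; lra.
Qed.

Let h_lt x y : V x -> V y -> h x < h y -> U x y.
Proof.
move=> Vx Vy hxy; case: (U_total Vx Vy) => [E|[//|Uyx]].
  by move: hxy; rewrite E ltxx.
by have := lt_trans hxy (h_strict Vy Uyx); rewrite ltxx.
Qed.

Let h_inj x y : V x -> V y -> h x = h y -> x = y.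
Proof.
move=> Vx Vy E; case: (U_total Vx Vy) => [//|[Uxy|Uyx]].
  by have := h_strict Vx Uxy; rewrite E ltxx.
by have := h_strict Vy Uyx; rewrite E ltxx.
Qed.

(** The image is an interval by connectedness, bounded by [s_bd], and open because each point of [V]
    has points of [V] on both sides. *)
Let h_image : exists a b, a < b /\ h @` V = `]a, b[%classic.
Proof.
have ih : is_interval (h @` V).
  apply/connected_intervalP; apply: connected_continuous_connected => //.
  by apply: continuous_in_subspaceT => x; rewrite inE; exact: h_cont.
have meets x S : V x -> open S -> S x -> (exists2 y, S y & U y x) /\ (exists2 y, S y & U x y).
  move=> Vx oS Sx; split.
    have [y [Ly Sy]] := piece_closure cV (LU Vx) Vx (open_nbhs_nbhs (conj oS Sx)).
    by exists y => //; apply/L_U => //; exact: LV Ly.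
  have [y [Uy Sy]] := piece_closure cV (piecesC (LU Vx)) Vx (open_nbhs_nbhs (conj oS Sx)).
  by exists y.
have oh : open (h @` V).
  apply: open_from_nbhs => _ [x Vx <-].
  have [[y Vy Uyx] [z Vz Uxz]] := meets x V Vx oV Vx.
  exists `]h y, h z[%classic; first by split; [exact: interval_open|rewrite /= in_itv/= !h_strict].
  move=> t /=; rewrite in_itv/= => /andP[yt tz].
  by apply: (ih (h y) (h z)); [exists y|exists z|rewrite !ltW].
have bl : has_lbound (h @` V).
  exists 0 => _ [x _ <-]; apply: le_trans (T_ub 0 x).
  by rewrite /s big_ord0.
have bu : has_ubound (h @` V).
  exists ((M + M) * 2) => _ [x _ <-]; exact: h_le.
have E := interval_bounded_interior ih bl bu.
rewrite ((interior_id (h @` V)).1 oh) in E.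
have EE : h @` V = `](inf (h @` V)), (sup (h @` V))[%classic.
  by rewrite {1}E; apply/seteqP; split => t /=; rewrite in_itv.
exists (inf (h @` V)), (sup (h @` V)); split => //.
case: V0 => x Vx; have : (h @` V) (h x) by exists x.
by rewrite {1}E => /andP[]; exact: lt_trans.
Qed.

Lemma ordered_open_arc : exists (k : R -> W) (a b : R), open_arc k a b V.
Proof.
have [a [b [ab hV]]] := h_image.
have [x0 Vx0] := V0.
have /choice[k kP] : forall t, exists y, t \in `]a, b[ -> V y /\ h y = t.
  move=> t; have [tab|_] := boolP (t \in _); last by exists x0.
  have : (h @` V) t by rewrite hV.
  by move=> [y Vy <-]; exists y.
have hab x : V x -> h x \in `]a, b[.
  by move=> Vx; have : (h @` V) (h x) by [exists x]; rewrite hV.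
have kh x : V x -> k (h x) = x.
  by move=> Vx; have [Vk E] := kP _ (hab _ Vx); exact: h_inj.
exists k, a, b; split => //.
- apply/seteqP; split=> [x Vx|_ [t tab <-]]; first by exists (h x); [exact: hab|exact: kh].
  by case: (kP t tab).
(* Continuity of the inverse: a connected neighbourhood of [k t] contains points [y] and [z] on both
   sides of [k t], hence by convexity the whole segment between them. *)
- move=> t tab S St; have [Vk ht] := kP t tab.
  have [|S' [oS' cS' S'k S'S]] := W_lc (_ : nbhs (k t) (V `&` S)).
    by apply: filterI => //; exact: open_nbhs_nbhs.
  have S'V : S' `<=` V by move=> z /S'S[].
  have [y [Ly Sy]] := piece_closure cV (LU Vk) Vk (open_nbhs_nbhs (conj oS' S'k)).
  have [z [Uz Sz]] := piece_closure cV (piecesC (LU Vk)) Vk (open_nbhs_nbhs (conj oS' S'k)).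
  have Vy := S'V _ Sy; have Vz := S'V _ Sz.
  change (nbhs t (k @^-1` S)).
  apply: (@filterS _ _ _ `]h y, h z[%classic).
    move=> u /=; rewrite in_itv/= => /andP[yu uz].
    have uab : u \in `]a, b[.
      have := hab _ Vy; have := hab _ Vz; rewrite !in_itv/= => /andP[_ zb] /andP[ay _].
      by rewrite (lt_trans ay yu) (lt_trans uz zb).
    have [Vku hu] := kP u uab.
    suff /S'S[] : S' (k u) by [].
    by apply: (convex cS' S'V Sy Sz); apply: h_lt => //; rewrite hu.
  apply: open_nbhs_nbhs; split; first exact: interval_open.
  rewrite /= in_itv/= -ht !h_strict//.
  exact/L_U.
- move=> t u tab uab E; have [_ <-] := kP _ tab; have [_ <-] := kP _ uab.
  by rewrite E.
- move=> u v au uv vb.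
  have -> : k @` `]u, v[ = V `&` h @^-1` `]u, v[.
    apply/seteqP; split=> [_ [t tuv <-]|x [Vx hx]]; last by exists (h x); [|exact: kh].
    have tab : t \in `]a, b[.
      move: tuv; rewrite /= !in_itv/= => /andP[ut tv].
      by rewrite (le_lt_trans au ut) (lt_le_trans tv vb).
    by have [Vk ht] := kP t tab; split => //; rewrite /preimage/= ht.
  have /(continuous_inP _ oV) : {in V, continuous h}.
    by move=> x; rewrite inE; exact: h_cont.
  by apply; exact: interval_open.
Qed.

End parametrization.

Lemma cut_open_arc (R : realType) (W : topologicalType) (g : W -> R)
    (d : nat -> W) (V : set W) :
  locally_connected W -> hausdorff_space W -> continuous g ->
  (forall S, connected S ->
    (forall x y, S x -> S y -> g x = g y) -> forall x y, S x -> S y -> x = y) ->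
  (forall U, open U -> U !=set0 -> exists n, U (d n)) ->
  (exists M, forall w, `|g w| <= M) ->
  open V -> connected V -> V !=set0 ->
  (forall x, V x -> exists A B, pieces (V `\` [set x]) A B) ->
  exists (k : R -> W) (a b : R), open_arc k a b V.
Proof.
move=> lc T2 gc gl dd [M gM] oV cV V0 cut.
have /choice[A /choice[B AB]] : forall x, exists A, exists B, V x -> pieces (V `\` [set x]) A B.
  move=> x; have [/cut//|nV] := pselect (V x); last by exists set0, set0.
  by move=> [A [B ?]]; exists A, B.
have [L [U [LU coh]]] := exists_orientation lc T2 gc gl dd oV cV AB V0.
exact: (ordered_open_arc lc gc gl dd gM oV cV V0 LU coh).
Qed.

(** * Arcs and stars *)

Section arcs.
Context {R : realType} {W : topologicalType}.
Implicit Types (k : R -> W) (a b s t : R) (S V C Q Z : set W).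

(** A closed arc with distinct ends whose interior is open in [W]. Continuity on the whole line,
    obtained by extending with constants, avoids subspace topologies. *)
Definition is_arc (k : R -> W) (a b : R) :=
  [/\ a < b, continuous k, {in `[a, b] &, injective k} &
      forall s t, a <= s -> s < t -> t <= b -> open (k @` `]s, t[)].

Lemma minr_cst_continuous (s : R) : continuous (fun t : R => Num.min t s).
Proof.
move=> x; apply: (@continuous_min R R id (fun=> s) x); first exact: cvg_id.
exact: cvg_cst.
Qed.

Lemma maxr_cst_continuous (s : R) : continuous (fun t : R => Num.max t s).
Proof.
move=> x; apply: (@continuous_max R R id (fun=> s) x); first exact: cvg_id.
exact: cvg_cst.
Qed.

Lemma eq_in_image_itv (k k' : R -> W) (a b s t : R) :
  {in `[a, b], k =1 k'} -> a <= s -> t <= b -> k @` `]s, t[ = k' @` `]s, t[.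
Proof.
move=> E as_ tb.
have H u : u \in `]s, t[ -> k u = k' u.
  rewrite !in_itv/= => /andP[su ut]; apply: E; rewrite in_itv/=.
  by rewrite (le_trans as_ (ltW su)) (le_trans (ltW ut) tb).
by apply/seteqP; split=> _ [u us <-]; exists u; rewrite ?H.
Qed.

Lemma open_arc_mid k a b V s t : open_arc k a b V -> a < s -> s < t -> t < b ->
  exists2 k', is_arc k' s t & k' @` `]s, t[ = k @` `]s, t[.
Proof.
move=> [ab VE kc ki ko] as_ st tb.
pose k' u := k (Num.max (Num.min u t) s).
have kk' : {in `[s, t], k' =1 k}.
  by move=> u; rewrite in_itv/= => /andP[su ut]; rewrite /k' min_l// max_l.
exists k'; last by exact: eq_in_image_itv kk' _ _.
split => //.
- move=> u; apply: (@continuous_comp _ _ _ (fun u => Num.max (Num.min u t) s) k).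
    apply: (@continuous_comp _ _ _ (fun u => Num.min u t) (fun u => Num.max u s)).
      exact: minr_cst_continuous.
    exact: maxr_cst_continuous.
  apply: kc; rewrite in_itv/= lt_max as_ orbT/=.
  by rewrite gt_max (lt_trans st tb) gt_min tb orbT.
- move=> u v us vs; rewrite !kk'//; apply: ki.
    by move: us; rewrite !in_itv/=; lra.
  by move: vs; rewrite !in_itv/=; lra.
- move=> u v su uv vt; rewrite (eq_in_image_itv kk')//; apply: ko => //; lra.
Qed.

Lemma open_arc_rev (k : R -> W) (a b : R) (V : set W) : open_arc k a b V ->
  open_arc (fun t => k (- t)) (- b) (- a) V.
Proof.
move=> [ab VE kc ki ko].
have img s t : (fun t => k (- t)) @` `]s, t[ = k @` `](- t), (- s)[.
  apply/seteqP; split=> _ [u us <-]; exists (- u); rewrite ?opprK//.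
    by move: us; rewrite /= !in_itv/=; lra.
  by move: us; rewrite /= !in_itv/=; lra.
split; first by rewrite ltrN2.
- by rewrite img !opprK.
- move=> t tab; apply: (@continuous_comp _ _ _ (fun u => - u) k).
    exact: opp_continuous.
  by apply: kc; move: tab; rewrite !in_itv/=; lra.
- move=> s t sab tab /ki E; apply: oppr_inj; apply: E.
    by move: sab; rewrite !in_itv/=; lra.
  by move: tab; rewrite !in_itv/=; lra.
- by move=> s t bs st ta; rewrite img; apply: ko; lra.
Qed.

Hypotheses (W_compact : compact [set: W]) (W_T2 : hausdorff_space W).

Lemma closed_compact (C : set W) : closed C -> compact C.
Proof. by move=> cC; apply: (subclosed_compact cC W_compact). Qed.

(** The images of the intervals [](a + e), (b - e)[] are open and increase to [V] as [e] decreases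
    to 0, so one of them contains the compact set [C]. *)
Lemma open_arc_exhaust k a b V C : open_arc k a b V -> closed C -> C `<=` V ->
  exists s t, [/\ a < s, s < t, t < b & C `<=` k @` `]s, t[].
Proof.
move=> [ab VE kc ki ko] cC CV.
have /compact_near_coveringP nC := closed_compact cC.
have H : \forall e \near (0:R)^'+, C `<=` k @` `](a + e), (b - e)[.
  apply: (nC R _ (fun e x => (k @` `](a + e), (b - e)[) x)).
  move=> x /CV; rewrite VE => -[t + <-]; rewrite /= in_itv/= => /andP[at_ tb].
  pose e := Num.min (t - a) (b - t) / 2.
  have e0 : 0 < e by rewrite divr_gt0// lt_min !subr_gt0 at_ tb.
  have ea : e < t - a.
    apply: (@lt_le_trans _ _ (e * 2)); first by rewrite ltr_pMr// ltr1n.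
    by rewrite divfK// ge_min lexx.
  have eb : e < b - t.
    apply: (@lt_le_trans _ _ (e * 2)); first by rewrite ltr_pMr// ltr1n.
    by rewrite divfK// ge_min lexx orbT.
  exists (k @` `](a + e), (b - e)[, [set u | u < e]) => /=.
    split; last exact: nbhs_right_lt.
    apply: open_nbhs_nbhs; split; first by apply: ko; lra.
    by exists t => //; rewrite /= in_itv/=; lra.
  move=> [y u] /= [[v + <-] ue]; rewrite /= in_itv/= => vI; exists v => //.
  by rewrite /= in_itv/=; lra.
have b0 : 0 < (b - a) / 2 by lra.
have [e [He /= [e0 eb]]] := filter_ex (filterI H (filterI (nbhs_right_gt 0) (nbhs_right_lt b0))).
by exists (a + e), (b - e); split => //; lra.
Qed.

Lemma open_arc_connected k a b V s t : open_arc k a b V -> a <= s -> t <= b ->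
  connected (k @` `]s, t[).
Proof.
move=> [ab VE kc ki ko] as_ tb; apply: connected_continuous_connected.
  by apply/connected_intervalP; exact: interval_is_interval.
apply: continuous_in_subspaceT => u; rewrite inE/= in_itv/= => /andP[su ut].
by apply: kc; rewrite in_itv/= (le_lt_trans as_ su) (lt_le_trans ut tb).
Qed.

(* An end of an arm either stays away from the centre [c] or converges to it:
   the compact set [closure Q `\` Q] is avoided by the end, and so is
   [closure Q `\` Q'] for every smaller neighbourhood [Q'] of [c]. *)
Lemma open_arc_end k a b V c Z Q : open_arc k a b V -> open Z -> V `&` Z = set0 ->
  ~ V c -> open Q -> Q c -> closure Q `<=` [set c] `|` V `|` Z ->
  exists s, [/\ a < s, s < b &
    k @` `]a, s[ `&` Q = set0 \/
    exists2 k', is_arc k' a s & k' @` `]a, s[ = k @` `]a, s[].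
Proof.
move=> kV oZ VZ nVc oQ Qc Qsub.
have nZ x : V x -> ~ Z x by exact: disjoint_notin.
have avoid Q' : open Q' -> Q' c ->
    exists2 s, a < s < b & forall t, t \in `]a, s[ -> closure Q (k t) -> Q' (k t).
  move=> oQ' Q'c; have [||s [t [as_ st tb H]]] := @open_arc_exhaust k a b V ((closure Q `\` Q') `\` Z) kV.
  - by do 2 (apply: closedD_open => //); exact: closed_closure.
  - by move=> x [[/Qsub[[->|//]|//]]].
  exists s; first by rewrite as_ (lt_trans st tb).
  move=> u; rewrite in_itv/= => /andP[au us] Qu; apply: contrapT => nQ'.
  case: (kV) => _ VE _ ki _.
  have uab : u \in `]a, b[ by rewrite in_itv/= au (lt_trans us (lt_trans st tb)).
  have Vu : V (k u) by rewrite VE; exists u.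
  have [v + /ki E] : (k @` `]s, t[) (k u) by apply: H; split => //; exact: nZ.
  rewrite /= in_itv/= => /andP[sv vt].
  have vab : v \in `]a, b[ by rewrite in_itv/= (lt_trans as_ sv) (lt_trans vt tb).
  by have := lt_trans us sv; rewrite (E vab uab) ltxx.
have [s1 /andP[as1 s1b] Hs1] := avoid Q oQ Qc.
(* Halving keeps [s] strictly below [s1], in the range where the extension [k1] is continuous. *)
pose s := (a + s1) / 2.
have as_ : a < s by rewrite /s; lra.
have ss1 : s < s1 by rewrite /s; lra.
have sb : s < b by lra.
exists s; split => //.
have [[x [[t tas <-] Qt]]|/set0P/negP/negbNE/eqP] := pselect (k @` `]a, s[ `&` Q !=set0); last by left.
(* The end is connected, meets [Q] and avoids the frontier of [Q]. *)
right; have Hin : k @` `]a, s1[ `<=` Q.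
  apply: (@connected_open_cover _ _ _ (~` closure Q)) => //.
  - by apply: (open_arc_connected kV) => //; exact: ltW.
  - exact/closed_openC/closed_closure.
  - move=> _ [u us <-]; have [cu|] := pselect (closure Q (k u)); last by right.
    by left; exact: Hs1.
  - by move=> y _ Qy; apply; exact: subset_closure.
  - exists (k t); split => //; exists t => //.
    by move: tas; rewrite /= !in_itv/=; lra.
case: (kV) => ab VE kc ki ko.
(* The end is closed up by the centre; continuity at [a] is [avoid] applied to arbitrary open
   neighbourhoods of [c]. *)
pose k1 t := if t <= a then c else k t.
have k1E u : a < u -> k1 u = k u by rewrite /k1 leNgt => ->.
have k1c u : u < s1 -> {for u, continuous k1}.
  move=> us1; case: (ltgtP u a) => [ua|au|E].
  - move=> N; rewrite /k1 (ltW ua) => Nc; change (nbhs u (k1 @^-1` N)).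
    apply: (@filterS _ _ _ [set v | v < a]); last exact: lt_nbhsl.
    by move=> v va; rewrite /preimage /k1 /= (ltW va); exact: nbhs_singleton.
  - move=> N; rewrite k1E// => Nc; change (nbhs u (k1 @^-1` N)).
    have uab : u \in `]a, b[ by rewrite in_itv/= au (lt_trans us1 s1b).
    have H : \forall v \near u, a < v by exact: lt_nbhsr.
    apply: filterS (filterI H (kc u uab N Nc)) => v [av].
    by rewrite /preimage /= k1E.
  - rewrite E => N; rewrite {1}/k1 lexx nbhsE => -[N' [oN' N'c] N'N].
    change (nbhs a (k1 @^-1` N)).
    have [s2 /andP[as2 s2b] H2] := avoid N' oN' N'c.
    have H : \forall v \near a, v < Num.min s1 s2.
      by apply: lt_nbhsl; rewrite lt_min as1.
    apply: filterS H => v; rewrite lt_min => /andP[vs1 vs2].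
    rewrite /preimage/= /k1; case: (leP v a) => [_|av]; apply: N'N => //.
    apply: H2; first by rewrite in_itv/= av.
    by apply/subset_closure/Hin; exists v => //; rewrite /= in_itv/= av.
pose k' u := k1 (Num.min u s).
have kk' : {in `[a, s], k' =1 k1}.
  by move=> u; rewrite in_itv/= => /andP[au us]; rewrite /k' min_l.
have img u v : a <= u -> v <= s -> k' @` `]u, v[ = k @` `]u, v[.
  move=> au vs; rewrite (eq_in_image_itv kk')//.
  have H t' : t' \in `]u, v[ -> k1 t' = k t'.
    by rewrite in_itv/= => /andP[ut _]; apply: k1E; exact: le_lt_trans ut.
  by apply/seteqP; split=> _ [t' tuv <-]; exists t'; rewrite ?H.
exists k'; last exact: img.
split => //.
- move=> u; apply: (@continuous_comp _ _ _ (fun u => Num.min u s) k1).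
    exact: minr_cst_continuous.
  by apply: k1c; rewrite gt_min ss1 orbT.
- have kV1 u : a < u -> u <= s -> V (k u).
    by move=> au us; rewrite VE; exists u => //; rewrite /= in_itv/=; lra.
  move=> u v us vs; rewrite !kk'//; move: us vs; rewrite !in_itv/= /k1.
  case: (leP u a) => ua; case: (leP v a) => va /andP[au us] /andP[av vs].
  + by move=> _; lra.
  + by move=> E; exfalso; apply: nVc; rewrite E; exact: kV1.
  + by move=> E; exfalso; apply: nVc; rewrite -E; exact: kV1.
  + by apply: ki; rewrite in_itv/=; lra.
- by move=> u v au uv vs; rewrite img//; apply: ko => //; lra.
Qed.

Definition covered_by_arcs (S : set W) := exists (P : set W)
    (A : set ((R -> W) * R * R)), [/\ finite_set P, finite_set A,
    forall al, A al -> is_arc al.1.1 al.1.2 al.2 &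
    S `<=` P `|` \bigcup_(al in A) (al.1.1 @` `]al.1.2, al.2[)].

Lemma covered_by_arcsW S S' : S `<=` S' -> covered_by_arcs S' -> covered_by_arcs S.
Proof. by move=> SS [P [A [fP fA Aarc H]]]; exists P, A; split => // x /SS/H. Qed.

Lemma covered_by_arcsU S S' : covered_by_arcs S -> covered_by_arcs S' ->
  covered_by_arcs (S `|` S').
Proof.
move=> [P [A [fP fA Aarc H]]] [P' [A' [fP' fA' Aarc' H']]].
exists (P `|` P'), (A `|` A'); split.
- by rewrite finite_setU.
- by rewrite finite_setU.
- by move=> al [/Aarc|/Aarc'].
- move=> x [/H[Px|[al Aal xal]]|/H'[Px|[al Aal xal]]].
  + by left; left.
  + by right; exists al => //; left.
  + by left; right.
  + by right; exists al => //; right.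
Qed.

Lemma covered_by_arcs1 x : covered_by_arcs [set x].
Proof.
by exists [set x], set0; split => //; left.
Qed.

Lemma covered_by_arcs0 : covered_by_arcs set0.
Proof. by exists set0, set0; split => //; exact: finite_set0. Qed.

Lemma covered_by_arcs_arc k a b : is_arc k a b -> covered_by_arcs (k @` `]a, b[).
Proof.
move=> ka; exists set0, [set (k, a, b)]; split => //.
- by move=> _ ->.
- by move=> x Hx; right; exists (k, a, b).
Qed.

Lemma covered_by_arcs_ord n (S : 'I_n -> set W) :
  (forall i, covered_by_arcs (S i)) -> covered_by_arcs (\bigcup_i S i).
Proof.
move=> H; suff : forall s : seq 'I_n, covered_by_arcs (\bigcup_(i in [set` s]) S i).
  move=> /(_ (enum 'I_n)); apply: covered_by_arcsW => x [i _ Si].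
  by exists i => //=; rewrite mem_enum.
elim=> [|i s IH].
  by apply: covered_by_arcsW covered_by_arcs0 => x [i].
apply: covered_by_arcsW (covered_by_arcsU (H i) IH) => x [j /=].
by rewrite inE => /orP[/eqP->|js] Sj; [left|right; exists j].
Qed.

(** If [Q setT] failed, the sets whose complement satisfies [Q] would form a proper filter, and a
    neighbourhood of a cluster point could not satisfy [Q]. *)
Lemma compact_local (Q : set W -> Prop) : Q set0 ->
  (forall S S', S `<=` S' -> Q S' -> Q S) ->
  (forall S S', Q S -> Q S' -> Q (S `|` S')) ->
  (forall x : W, exists2 N, nbhs x N & Q N) -> Q setT.
Proof.
move=> Q0 QW QU Qx; apply: contrapT => nQ.
pose F : set_system W := [set S | Q (~` S)].
have FF : ProperFilter F.
  split; first by rewrite /F /= setC0.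
  split; rewrite /F /=; first by rewrite setCT.
    by move=> S S' /= QS QS'; rewrite setCI; exact: QU.
  by move=> S S' SS'; apply: QW; exact: subsetC.
have [|x [_ cx]] := W_compact FF; first by rewrite /F /= setCT.
have [N Nx QN] := Qx x.
have FN : F (~` N) by rewrite /F /= setCK.
by have [y []] := cx _ _ FN Nx.
Qed.

Lemma open_arc_covered k a b V x : open_arc k a b V -> V x ->
  exists2 N, nbhs x N & covered_by_arcs N.
Proof.
move=> kV; case: (kV) => ab VE kc ki ko; rewrite VE => -[t + <-].
rewrite /= in_itv/= => /andP[at_ tb].
pose s := (a + t) / 2; pose u := (t + b) / 2.
have [|||k' ka' E] := open_arc_mid (s := s) (t := u) kV; rewrite ?/s ?/u; try lra.
exists (k @` `]s, u[); last by rewrite -E; exact: covered_by_arcs_arc.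
apply: open_nbhs_nbhs; split; first by apply: ko; rewrite /s /u; lra.
by exists t => //; rewrite /= in_itv/= /s /u; lra.
Qed.

(** Inside a neighbourhood [Q] of the centre with closure in [N], each arm is divided into its two
    ends, handled by [open_arc_end] (the second after reversal), and a middle arc. *)
Lemma star_covered n (V : 'I_n -> set W) c N : open N -> N c ->
  N `\` [set c] = \bigcup_i V i -> trivIset setT V ->
  (forall i, exists k a b, open_arc k a b (V i)) ->
  exists2 N, nbhs c N & covered_by_arcs N.
Proof.
move=> oN Nc NE tV arcV.
have oV i : open (V i).
  have [k [a [b [ab -> _ _ ko]]]] := arcV i; apply: ko => //; exact: lexx.
have nVc i : ~ V i c.
  move=> Vc; have : (N `\` [set c]) c by rewrite NE; exists i.
  by case=> _; apply.
have [S] := compact_regular W_T2 W_compact (@filterT _ _ (nbhs_filter c)) (open_nbhs_nbhs (conj oN Nc)).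
rewrite {1}nbhsE => -[Q [oQ Qc] QS] SN.
have QN : closure Q `<=` N by move=> x /(closureS QS)/SN.
exists Q; first exact: open_nbhs_nbhs.
suff H i : covered_by_arcs (Q `&` V i).
  apply: covered_by_arcsW (covered_by_arcsU (covered_by_arcs1 c) (covered_by_arcs_ord H)).
  move=> x Qx; have [->|xc] := pselect (x = c); first by left.
  have : (N `\` [set c]) x by split => //; exact/QN/subset_closure.
  by rewrite NE => -[i _ Vx]; right; exists i.
have [k [a [b kV]]] := arcV i.
(* The other arms are open and disjoint from arm [i]; with the centre they make up the rest of
   [N]. *)
pose Z := \bigcup_(j in [set j | j != i]) V j.
have oZ : open Z by apply: bigcup_open => j _; exact: oV.
have VZ : V i `&` Z = set0.
  apply/seteqP; split=> // x [Vi [j ji Vj]].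
  have := tV i j I I; rewrite /= => /(_ (ex_intro _ x (conj Vi Vj))) E.
  by move: ji; rewrite /= E eqxx.
have Qsub : closure Q `<=` [set c] `|` V i `|` Z.
  move=> x /QN Nx; have [->|xc] := pselect (x = c); first by left; left.
  have : (N `\` [set c]) x by [].
  rewrite NE => -[j _ Vj]; have [<-|ji] := eqVneq j i; first by left; right.
  by right; exists j.
have [s [as_ sb Hs]] := open_arc_end kV oZ VZ (nVc i) oQ Qc Qsub.
have kV' := open_arc_rev kV.
have [t [bt ta Ht]] := open_arc_end kV' oZ VZ (nVc i) oQ Qc Qsub.
case: (kV) => ab VE _ _ _.
have left_cov : covered_by_arcs (Q `&` (k @` `]a, s[)).
  case: Hs => [E|[k' ka' E]]; first by rewrite setIC E; exact: covered_by_arcs0.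
  rewrite -E; apply: covered_by_arcsW (covered_by_arcs_arc ka') => x; by case.
have right_cov : covered_by_arcs (Q `&` ((fun u => k (- u)) @` `](- b), t[)).
  case: Ht => [E|[k' ka' E]]; first by rewrite setIC E; exact: covered_by_arcs0.
  rewrite -E; apply: covered_by_arcsW (covered_by_arcs_arc ka') => x; by case.
(* The middle arc starts before and stops after both [s] and [- t], so the three parts cover the arm
   in whichever order these two come. *)
pose s' := Num.min ((a + s) / 2) (((- t) + a) / 2).
pose t' := Num.max ((s + b) / 2) (((- t) + b) / 2).
have [|||k' ka' E] := open_arc_mid (s := s') (t := t') kV.
- by rewrite lt_min; lra.
- by rewrite gt_min; apply/orP; left; rewrite lt_max; apply/orP; left; lra.
- by rewrite gt_max; lra.
have mid_cov : covered_by_arcs (k @` `]s', t'[).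
  by rewrite -E; exact: covered_by_arcs_arc.
apply: covered_by_arcsW (covered_by_arcsU left_cov (covered_by_arcsU mid_cov right_cov)).
move=> x [Qx]; rewrite VE => -[u + ux]; rewrite -{x}ux in Qx *.
rewrite /= in_itv/= => /andP[au ub].
case: (ltP u s) => us.
  by left; split; [|exists u => //; rewrite /= in_itv/= au].
right; case: (ltP (- t) u) => tu.
  right; split => //; exists (- u); rewrite ?opprK//.
  by rewrite /= in_itv/=; lra.
left; exists u => //; rewrite /= in_itv/=; apply/andP; split.
  by rewrite gt_min; apply/orP; left; lra.
by rewrite lt_max; apply/orP; right; lra.
Qed.

End arcs.

(** * Graphs *)

Section realization_theory.
Context {R : realType} {G : finite_multigraph}.
Implicit Types (v : vertex G) (e : edge G) (t : R).

Definition clamp t : R := Num.max (Num.min t 1) 0.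

Lemma clamp_itv t : clamp t \in `[0, 1]%classic.
Proof.
by rewrite inE /= in_itv/= /clamp le_max lexx orbT/= ge_max ler01 ge_min lexx orbT.
Qed.

Lemma clampE t : 0 <= t <= 1 -> clamp t = t.
Proof. by move=> /andP[t0 t1]; rewrite /clamp min_l// max_l. Qed.

(** Clamping makes every edge a map on the whole line. *)
Definition edge_point e t : cells R G :=
  existT (cell_space R) (inr e) (SigSub (clamp_itv t)).

Lemma vertex_itv : 0 \in ([set 0] : set R). Proof. by rewrite inE. Qed.

Definition vertex_point v : cells R G :=
  existT (cell_space R) (inl v) (SigSub vertex_itv).

Lemma clamp_continuous : continuous clamp.
Proof.
move=> t; rewrite /clamp.
apply: (@continuous_comp _ _ _ (fun u : R => Num.min u 1) (fun u : R => Num.max u 0)).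
  exact: minr_cst_continuous.
exact: maxr_cst_continuous.
Qed.

Lemma edge_point_continuous e : continuous (edge_point e).
Proof.
move=> t; apply: (@continuous_comp _ _ _ (fun t => SigSub (clamp_itv t) : cell_space R (inr e))
  (existT (cell_space R) (inr e))); last exact: existT_continuous.
apply: continuous_comp_initial t.
rewrite (_ : _ \o _ = clamp)//; exact: clamp_continuous.
Qed.

Lemma cell_itv e (x : cell_space R (inr e)) : 0 <= set_val x <= 1.
Proof. by have := set_valP x; rewrite /= in_itv. Qed.

Lemma edge_pointE e (x : cell_space R (inr e)) :
  existT (cell_space R) (inr e) x = edge_point e (set_val x).
Proof.
rewrite /edge_point; congr existT; apply: val_inj => /=.
by rewrite clampE// cell_itv.
Qed.

Lemma vertex_pointE v (x : cell_space R (inl v)) :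
  existT (cell_space R) (inl v) x = vertex_point v.
Proof.
rewrite /vertex_point; congr existT; apply: val_inj => /=.
exact: (set_valP x).
Qed.

Lemma cells_cases (p : cells R G) :
  (exists v, p = vertex_point v) \/ (exists e t, 0 <= t <= 1 /\ p = edge_point e t).
Proof.
case: p => -[v|e] x; first by left; exists v; exact: vertex_pointE.
by right; exists e, (set_val x); split; [exact: cell_itv|exact: edge_pointE].
Qed.

Definition edge_value e t : vertex G + edge G * R :=
  if t <= 0 then inl (edge_src e) else if 1 <= t then inl (edge_tgt e)
  else inr (e, t).

Lemma attach_edge e t : attach (edge_point e t) = edge_value e t.
Proof.
rewrite /attach /edge_value /= (_ : set_val _ = clamp t)// /clamp.
case: (leP t 0) => t0.
  by rewrite min_l ?(le_trans t0)// max_r// eqxx.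
case: (leP 1 t) => t1; first by rewrite max_l// oner_eq0 eqxx.
by rewrite max_l ?ltW// gt_eqF// lt_eqF.
Qed.

(* [attach] is constant on glueing classes, so the choice of [repr] is harmless. *)
Definition place (z : realization R G) : vertex G + edge G * R :=
  attach (repr z).

Lemma place_pi p : place (\pi_(realization R G) p) = attach p.
Proof.
rewrite /place; case: piP => q /eqquotP /eqP; by [].
Qed.

Lemma place_inj : injective place.
Proof.
move=> z w E; rewrite -(reprK z) -(reprK w); apply/eqquotP.
by apply/eqP.
Qed.

Definition redge e t : realization R G := \pi_(realization R G) (edge_point e t).
Definition rvertex v : realization R G := \pi_(realization R G) (vertex_point v).

Lemma redge_continuous e : continuous (redge e).
Proof.
move=> t; apply: (@continuous_comp _ _ _ (edge_point e) (\pi_(realization R G))).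
  exact: edge_point_continuous.
exact: pi_continuous.
Qed.

Lemma place_redge e t : place (redge e t) = edge_value e t.
Proof. by rewrite place_pi attach_edge. Qed.

Lemma place_rvertex v : place (rvertex v) = inl v.
Proof. by rewrite place_pi. Qed.

Lemma realization_cases z : (exists v, z = rvertex v) \/
  (exists e t, 0 < t < 1 /\ z = redge e t).
Proof.
rewrite -(reprK z); case: (cells_cases (repr z)) => [[v ->]|[e [t [/andP[t0 t1] ->]]]].
  by left; exists v.
have [t0'|t0'] := leP t 0.
  left; exists (edge_src e); apply: place_inj.
  by rewrite place_rvertex place_redge /edge_value t0'.
have [t1'|t1'] := leP 1 t.
  left; exists (edge_tgt e); apply: place_inj.
  by rewrite place_rvertex place_redge /edge_value leNgt t0'/= t1'.
by right; exists e, t; rewrite t0' t1'.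
Qed.

(** Openness in the quotient is tested cell by cell. Vertex cells are single points, so only the
    traces on the edges impose a condition. *)
Lemma realization_open (S : set (vertex G + edge G * R)) :
  (forall e, exists2 Q : set R, open Q &
     forall t, 0 <= t <= 1 -> S (edge_value e t) <-> Q t) ->
  open (place @^-1` S).
Proof.
move=> H; suff : open (\pi_(realization R G) @^-1` (place @^-1` S)) by [].
apply/sigT_openP => -[v|e].
  have [Sv|nS] := pselect (S (inl v)).
    rewrite (_ : _ @^-1` _ = setT); first exact: openT.
    by apply/seteqP; split => // x _; rewrite /preimage/= vertex_pointE place_rvertex.
  rewrite (_ : _ @^-1` _ = set0); first exact: open0.
  by apply/seteqP; split => // x; rewrite /preimage/= vertex_pointE place_rvertex.
have [Q oQ HQ] := H e; exists Q => //.
apply/seteqP; split => x; rewrite /preimage/= edge_pointE place_redge;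
  by move=> /(HQ _ (cell_itv x)).
Qed.

Lemma realization_compact : compact [set: realization R G].
Proof.
have -> : [set: realization R G] =
    \pi_(realization R G) @` [set: cells R G].
  by apply/seteqP; split => // z _; exists (repr z) => //; rewrite reprK.
apply: continuous_compact.
  by apply: continuous_subspaceT => x; exact: pi_continuous.
apply: sigT_compact; first exact: finite_finset.
case=> [v|e].
  rewrite (_ : setT = [set SigSub vertex_itv]); first exact: compact_set1.
  apply/seteqP; split => // x _; apply: val_inj => /=; exact: (set_valP x).
rewrite (_ : setT = (fun t => SigSub (clamp_itv t) : cell_space R (inr e)) @` `[0, 1]).
  apply: continuous_compact; last exact: segment_compact.
  apply: continuous_subspaceT; apply: continuous_comp_initial.
  rewrite (_ : _ \o _ = clamp)//; exact: clamp_continuous.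
apply/seteqP; split => // x _; exists (set_val x).
  by rewrite /= in_itv/= cell_itv.
by apply: val_inj => /=; rewrite clampE// cell_itv.
Qed.

End realization_theory.
Arguments edge_point {R G} e t.
Arguments redge {R G} e t.
Arguments rvertex {R G} v.

Lemma closed_gap (R : realType) (B : set R) (a b t : R) : closed B -> B a -> B b ->
  a < t < b -> ~ B t ->
  exists s u, [/\ a <= s < t, t < u <= b, B s, B u & forall x, s < x < u -> ~ B x].
Proof.
move=> cB Ba Bb /andP[at_ tb] nBt.
suff left_gap (C : set R) c : closed C -> C c -> c < t -> ~ C t ->
    exists s, [/\ c <= s < t, C s & forall x, s < x <= t -> ~ C x].
  have [s [sa Bs Hs]] := left_gap B a cB Ba at_ nBt.
  (* The upper end of the gap is the lower end for the reflection of [B] in [t]. *)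
  have [||||u [ub Bu Hu]] := left_gap (fun x => B (t + t - x)) (t + t - b).
  - apply: (@closed_comp _ _ (fun x => t + t - x)) => // x _.
    by apply: cvgB; [exact: cvg_cst|exact: cvg_id].
  - by rewrite subKr.
  - lra.
  - by rewrite addrK.
  exists s, (t + t - u); split => //; first lra.
  move=> x /andP[sx xu]; case: (leP x t) => xt; first by apply: Hs; rewrite sx.
  have /Hu : u < t + t - x <= t by lra.
  by rewrite subKr.
move=> cC Cc ct nCt.
pose S := [set x | C x /\ x <= t].
have cS : closed S by apply: closedI => //; exact: closed_le.
have S0 : S !=set0 by exists c; split => //; exact: ltW.
have Sb : has_ubound S by exists t => x [].
have Ss : S (sup S) by apply: cS; exact: closure_sup.
have [Cs st] := Ss.
exists (sup S); split => //.
  rewrite lt_neqAle st andbT ub_le_sup//=; last by split => //; exact: ltW.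
  by apply/eqP => E; rewrite E in Cs.
move=> x /andP[sx xt] Cx; have : x <= sup S by apply: ub_le_sup.
by rewrite leNgt sx.
Qed.

Section graphs.
Context {R : realType} {W : topologicalType}.
Hypotheses (W_compact : compact [set: W]) (W_T2 : hausdorff_space W).

(** Points of [F] serve as vertices and members of [EE] as edges. The resulting map from the
    realization is a continuous bijection from a compact space to a Hausdorff one, hence a
    homeomorphism. *)
Lemma graph_of_edges (F : set W) (EE : set (set W)) :
  finite_set F -> finite_set EE -> [set: W] `<=` F `|` \bigcup_(E in EE) E ->
  (forall E x, EE E -> E x -> ~ F x) ->
  (forall E E' x, EE E -> EE E' -> E x -> E' x -> E = E') ->
  (forall E, EE E -> exists c : R -> W, [/\ continuous c, F (c 0), F (c 1),
    c @` `]0, 1[ = E & {in `]0, 1[ &, injective c}]) ->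
  is_finite_graph R W.
Proof.
move=> /finite_fsetP[X FX] /finite_fsetP[Y EY] cover EF EE1 edgeE.
have YE (e : Y) : EE (val e) by rewrite EY /=; exact: valP.
have /choice[c cP] : forall e : Y, exists c : R -> W,
    [/\ continuous c, F (c 0), F (c 1), c @` `]0, 1[ = val e &
       {in `]0, 1[ &, injective c}].
  by move=> e; exact: edgeE (YE e).
have XF (v : X) : F (val v) by rewrite FX /=; exact: valP.
have FXv w : F w -> exists v : X, val v = w.
  by rewrite FX /= => wX; exists (FSetSub wX).
have /choice[src srcP] : forall e : Y, exists v : X, val v = c e 0.
  by move=> e; apply: FXv; case: (cP e).
have /choice[tgt tgtP] : forall e : Y, exists v : X, val v = c e 1.
  by move=> e; apply: FXv; case: (cP e).
pose G := FiniteMultigraph src tgt.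
pose point (p : vertex G + edge G * R) : W :=
  match p with inl v => val v | inr et => c et.1 et.2 end.
pose psi (z : realization R G) : W := point (place z).
have psi_vertex v : psi (rvertex v) = val v by rewrite /psi place_rvertex.
have psi_edge (e : edge G) t : 0 <= t <= 1 -> psi (redge e t) = c e t.
  move=> /andP[t0 t1]; rewrite /psi place_redge /edge_value.
  case: leP => t0'.
    by rewrite /= srcP; congr (c _ _); apply/eqP; rewrite eq_le t0 t0'.
  case: leP => t1' //=.
  by rewrite tgtP; congr (c _ _); apply/eqP; rewrite eq_le t1 t1'.
have in_edge (e : edge G) t : 0 < t < 1 -> val e (c e t).
  move=> t01; case: (cP e) => _ _ _ E _; rewrite -[X in X (c _ _)]E.
  by exists t.
have psi_inj : injective psi.
  move=> z z'; case: (realization_cases z) => [[v ->]|[e [t [t01 ->]]]];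
    case: (realization_cases z') => [[v' ->]|[e' [t' [t01' ->]]]].
  - by rewrite !psi_vertex => /val_inj ->.
  - have /andP[t0 t1] := t01'.
    rewrite psi_vertex psi_edge ?ltW// => E; exfalso.
    by apply: (EF _ _ (YE e') (in_edge _ _ t01')); rewrite -E.
  - have /andP[t0 t1] := t01.
    rewrite psi_vertex psi_edge ?ltW// => E; exfalso.
    by apply: (EF _ _ (YE e) (in_edge _ _ t01)); rewrite E.
  - have /andP[t0 t1] := t01; have /andP[t0' t1'] := t01'.
    rewrite !psi_edge ?ltW// => E.
    have ee' : e = e'.
      apply: val_inj; apply: (EE1 _ _ _ (YE e) (YE e') (in_edge _ _ t01)).
      by rewrite E; exact: in_edge.
    rewrite -ee' in E *; case: (cP e) => _ _ _ _ cinj.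
    by rewrite (cinj _ _ _ _ E)// in_itv.
have psi_surj w : exists z, psi z = w.
  have [/FXv[v <-]|[E EEE Ew]] := cover w I; first by exists (rvertex (v : vertex G)).
  move: (EEE); rewrite EY /= => EinY; pose e : edge G := FSetSub EinY.
  case: (cP e) => _ _ _ cE _.
  have : (c e @` `]0, 1[) w by rewrite cE.
  case=> t.
  rewrite /= in_itv/= => /andP[t0 t1] <-.
  by exists (redge e t); rewrite psi_edge// !ltW.
have psi_cont : continuous psi.
  apply/quotient_continuous.
  pose f (i : vertex G + edge G) : cell_space R i -> W :=
    match i with inl v => fun=> val v | inr e => fun x => c e (set_val x) end.
  have -> : psi \o \pi_(realization R G) = (fun p => f (projT1 p) (projT2 p)).
    apply/funext => -[[v|e] x] /=.
      apply: etrans (psi_vertex v).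
      exact: (congr1 (fun p => psi (\pi_(realization R G) p)) (@vertex_pointE R G v x)).
    apply: etrans (psi_edge e _ (@cell_itv R G e x)).
    exact: (congr1 (fun p => psi (\pi_(realization R G) p)) (@edge_pointE R G e x)).
  apply: (@sigT_continuous _ _ _ f) => -[v|e]; first by exact: cst_continuous.
  move=> x; apply: (@continuous_comp _ _ _ set_val (c e)).
    exact: initial_continuous.
  by case: (cP e) => cc _ _ _ _; exact: cc.
have /choice[phi phiP] := psi_surj.
exists G, phi, psi; split => //.
  by move=> z; apply: psi_inj; rewrite phiP.
apply/continuous_closedP => C cC.
have -> : phi @^-1` C = psi @` C.
  apply/seteqP; split => [w Cw|_ [z Cz <-]]; first by exists (phi w).
  by rewrite /preimage/= (_ : phi (psi z) = z)//; apply: psi_inj; rewrite phiP.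
apply: compact_closed => //; apply: continuous_compact.
  exact: continuous_subspaceT.
exact: (subclosed_compact cC realization_compact).
Qed.

(** [F] collects the exceptional points and the ends of the arcs; [EE] consists of the stretches of
    arcs between consecutive parameters sent into [F]. *)
Lemma graph_of_arcs : @covered_by_arcs R W setT -> is_finite_graph R W.
Proof.
move=> [P [A [fP fA arcA cover]]].
pose F := P `|` [set al.1.1 al.1.2 | al in A] `|` [set al.1.1 al.2 | al in A].
have fF : finite_set F by rewrite !finite_setU; split; [split|]; rewrite //; exact: finite_image.
have cF : closed F.
  by apply: (accessible_finite_set_closed.1 (hausdorff_accessible W_T2)).
pose sub (al : (R -> W) * R * R) s u E :=
  [/\ al.1.2 <= s, s < u, u <= al.2 & E = al.1.1 @` `]s, u[].
pose EE := [set E | exists al s u, [/\ A al, sub al s u E, F (al.1.1 s), F (al.1.1 u) &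
   forall x, E x -> ~ F x]].
have EE_open E : EE E -> open E /\ connected E.
  move=> [al [s [u [Aal [as_ su ub ->] _ _ _]]]].
  have [ab kc ki ko] := arcA _ Aal; split; first exact: ko.
  apply: connected_continuous_connected; last exact: continuous_subspaceT.
  by apply/connected_intervalP; exact: interval_is_interval.
(* The closed stretch adds to the open set [D] only two points of [F], which the connected [D']
   avoids; so [D'] cannot leave [D]. *)
have EE1 E E' x : EE E -> EE E' -> E x -> E' x -> E = E'.
  suff H D D' : EE D -> EE D' -> D x -> D' x -> D' `<=` D.
    by move=> HE HE' Ex E'x; apply/seteqP; split; exact: H.
  move=> HD HD' Dx D'x; have [oD _] := EE_open _ HD; have [_ cD'] := EE_open _ HD'.
  case: HD => al [s [u [Aal [as_ su ub DE] Fs Fu DF]]].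
  case: HD' => al' [s' [u' [_ _ _ _ DF']]].
  have [ab kc ki ko] := arcA _ Aal.
  have clK : closed (al.1.1 @` `[s, u]).
    apply: compact_closed => //; apply: continuous_compact; last exact: segment_compact.
    exact: continuous_subspaceT.
  apply: (@connected_open_cover _ _ _ (~` (al.1.1 @` `[s, u]))) => //.
  - exact: closed_openC.
  - move=> y D'y; have [[t + ty]|] := pselect ((al.1.1 @` `[s, u]) y); last by right.
    rewrite /= in_itv/= !le_eqVlt => /andP[/orP[/eqP E0|st] /orP[/eqP E1|tu]].
    + by exfalso; apply: (DF' y D'y); rewrite -ty -E0.
    + by exfalso; apply: (DF' y D'y); rewrite -ty -E0.
    + by exfalso; apply: (DF' y D'y); rewrite -ty E1.
    + by left; rewrite DE; exists t => //; rewrite /= in_itv/= st.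
  - move=> y _; rewrite DE => -[t tsu <-]; apply; exists t => //.
    by move: tsu; rewrite /= !in_itv/=; lra.
  - by exists x.
have fEE : finite_set EE.
  (* An edge is determined by an arc carrying it and its starting point in [F]: two edges with the
     same data share points just after the start. *)
  pose rel (p : (R -> W) * R * R * W) E :=
    exists s u, [/\ A p.1, sub p.1 s u E, p.1.1.1 s = p.2 & EE E].
  have relP p E E' : rel p E -> rel p E' -> E = E'.
    move=> [s [u [Ap [as_ su ub DE] sp HE]]] [s' [u' [_ [as_' su' ub' DE'] sp' HE']]].
    have [ab kc ki ko] := arcA _ Ap.
    have ss' : s = s' by apply: ki; rewrite ?in_itv/=; [lra|lra|rewrite sp].
    subst s'; pose t := (s + Num.min u u') / 2.
    have st : s < t by rewrite /t ltr_pdivlMr// mulr_natr mulr2n ltrD2l lt_min su su'.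
    have tm : t < Num.min u u'.
      by rewrite /t ltr_pdivrMr// mulr_natr mulr2n ltrD2r lt_min su su'.
    move: tm; rewrite lt_min => /andP[tu tu'].
    apply: (EE1 _ _ (p.1.1.1 t)) => //; [rewrite DE|rewrite DE'];
      by exists t => //; rewrite /= in_itv/= st.
  have /choice[psi psiP] : forall p, exists E, forall E', rel p E' -> E' = E.
    move=> p; have [[E HE]|nE] := pselect (exists E, rel p E).
      by exists E => E' HE'; exact: relP HE' HE.
    by exists set0 => E HE; exfalso; apply: nE; exists E.
  apply: (@sub_finite_set _ _ (psi @` (A `*` F))).
    move=> E HE; case: (HE) => al [s [u [Aal Hsub Fs Fu EF]]].
    exists (al, al.1.1 s); first by split.
    by apply/esym/psiP; exists s, u.
  by apply: finite_image; exact: finite_setX.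
apply: (graph_of_edges fF fEE).
- move=> x _; have [Fx|nFx] := pselect (F x); [by left|right].
  have [Px|[al Aal [t + tx]]] := cover x I; first by exfalso; apply: nFx; left; left.
  rewrite /= in_itv/= => tab.
  have [ab kc ki ko] := arcA _ Aal.
  have [|||||s [u [/andP[as_ st] /andP[tu ub] Fs Fu H]]] := @closed_gap _ (al.1.1 @^-1` F) al.1.2 al.2 t => //.
  + by apply: closed_comp => // y _; exact: kc.
  + by left; right; exists al.
  + by right; exists al.
  + by rewrite /preimage/= tx.
  exists (al.1.1 @` `]s, u[); last by exists t => //; rewrite /= in_itv/= st.
  exists al, s, u; split => //; first by split => //; exact: lt_trans tu.
  by move=> _ [v + <-]; rewrite /= in_itv/=; exact: H.
- by move=> E x [al [s [u [_ _ _ _]]]]; apply.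
- exact: EE1.
- move=> E [al [s [u [Aal [as_ su ub ->] Fs Fu EF]]]].
  have [ab kc ki ko] := arcA _ Aal.
  exists (fun t => al.1.1 (s + t * (u - s))); split.
  + move=> t; apply: (@continuous_comp R R W (fun t : R => s + t * (u - s)) al.1.1); last exact: kc.
    apply: cvgD; first exact: cvg_cst.
    by apply: cvgM; [exact: cvg_id|exact: cvg_cst].
  + by rewrite mul0r addr0.
  + by rewrite mul1r addrC subrK.
  + apply/seteqP; split=> _ [t + <-]; rewrite /= in_itv/= => /andP[t0 t1].
      exists (s + t * (u - s)) => //; rewrite /= in_itv/=; nra.
    exists ((t - s) / (u - s)); last first.
      by rewrite divfK; [rewrite addrC subrK|rewrite gt_eqF// subr_gt0].
    rewrite /= in_itv/= divr_gt0 ?subr_gt0//= ltr_pdivrMr ?subr_gt0//.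
    by rewrite mul1r ltrD2r.
  + move=> t t'; rewrite !in_itv/= => /andP[t0 t1] /andP[t0' t1'] E'.
    have : s + t * (u - s) = s + t' * (u - s).
      by apply: ki => //; rewrite in_itv/=; nra.
    by move=> /addrI /mulIf; apply; rewrite gt_eqF// subr_gt0.
Qed.

End graphs.

(** * The Reeb space *)

Section reeb_quotient.
Context {R : realType} {X : topologicalType} (f : X -> R).
Local Notation W := (reeb_space f).
Local Notation q := (reeb_quot f).

Lemma reeb_quotP x y : q x = q y <-> f x = f y /\ contour_of f x y.
Proof.
by rewrite /reeb_quot; split=> [/eqquotP/asboolP|H]; last exact/eqquotP/asboolP.
Qed.

Lemma reeb_quot_surj w : exists x, q x = w.
Proof. by exists (repr w); rewrite /reeb_quot reprK. Qed.

Lemma reeb_quot_continuous : continuous q.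
Proof. exact: pi_continuous. Qed.

Lemma reeb_openE (A : set W) : open A = open (q @^-1` A).
Proof. by []. Qed.

Lemma reeb_closedE (A : set W) : closed A <-> closed (q @^-1` A).
Proof. by rewrite -!openC preimage_setC. Qed.

Lemma reeb_fibre x : q @^-1` [set q x] = contour_of f x.
Proof.
apply/seteqP; split => y /=; first by move/esym/reeb_quotP => [].
move=> xy; apply/esym/reeb_quotP; split => //.
by have /= -> := connected_component_sub xy.
Qed.

Lemma reeb_fibre_connected w : connected (q @^-1` [set w]).
Proof.
have [x <-] := reeb_quot_surj w.
rewrite reeb_fibre; exact: component_connected.
Qed.

Lemma saturatedP (A : set X) : saturated f A <-> (forall x y, q x = q y -> A x -> A y).
Proof.
split=> [sA x y xy Ax|H]; first by rewrite -sA; exists x.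
by apply/seteqP; split => [x [y Ay yx]|]; [exact: H yx Ay|exact: preimage_image].
Qed.

Lemma saturated_preim (A : set W) : saturated f (q @^-1` A).
Proof. by apply/saturatedP => x y; rewrite /preimage /= => ->. Qed.

Lemma open_image_saturated A : saturated f A -> open A -> open (q @` A).
Proof. by move=> sA; rewrite reeb_openE sA. Qed.

Definition reeb_map (w : W) : R := f (repr w).

Lemma reeb_mapE x : reeb_map (q x) = f x.
Proof.
by have /reeb_quotP[] : q (repr (q x)) = q x by rewrite /reeb_quot reprK.
Qed.

(** Fibres are connected, so both parts of a separation of the preimage are saturated and descend to
    a separation of [A]. The closed case is used for lightness, the open one for cylinders and
    stars. *)
Lemma reeb_preim_connected (A : set W) : open A \/ closed A -> connected A ->
  connected (q @^-1` A).
Proof.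
move=> ocA cA; apply: connected_intro.
  by case: ocA => hA; [left|right; exact/reeb_closedE].
have sat U V : open U /\ open V \/ closed U /\ closed V ->
    q @^-1` A = U `|` V -> U `&` V = set0 -> saturated f U.
  move=> hUV AE UV; apply/saturatedP => x y xy Ux.
  have : q @^-1` [set q x] `<=` U.
    apply: (@connected_cover _ _ _ V) => //; first exact: reeb_fibre_connected.
    - rewrite -AE => z /= zx; rewrite /preimage /= zx.
      by have : (q @^-1` A) x by rewrite AE; left.
    - by move=> z _; exact: disjoint_notin.
    - by exists x.
  by apply; rewrite /preimage /=.
move=> U V hUV AE UV [x Ux]; have sU := sat _ _ hUV AE UV.
have sV : saturated f V.
  apply: (sat V U); rewrite 1?setUC 1?setIC//.
  by case: hUV => -[]; [left|right].
have AU : A `<=` q @` U.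
  apply: (@connected_cover _ _ _ (q @` V)) => //.
  - case: hUV => -[hU hV]; [left|right]; split.
    + exact: open_image_saturated.
    + exact: open_image_saturated.
    + by apply/reeb_closedE; rewrite sU.
    + by apply/reeb_closedE; rewrite sV.
  - move=> w; have [y <-] := reeb_quot_surj w => Ay.
    have : (q @^-1` A) y by [].
    by rewrite AE => -[]; [left|right]; exists y.
  - move=> _ _ [y Uy <-] [z Vz zy].
    exact: (disjoint_notin UV Uy ((saturatedP V).1 sV _ _ zy Vz)).
  - exists (q x); split; last by exists x.
    by have : (q @^-1` A) x by rewrite AE; left.
apply/seteqP; split => // y Vy.
have : (q @^-1` A) y by rewrite AE; right.
move=> /AU[z Uz zy]; apply: (disjoint_notin UV _ Vy).
exact: (saturatedP U).1 sU _ _ zy Uz.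
Qed.

Lemma pieces_preim (A C1 C2 : set W) z : pieces (A `\` [set z]) C1 C2 ->
  pieces (q @^-1` A `\` q @^-1` [set z]) (q @^-1` C1) (q @^-1` C2).
Proof.
move=> [[oC1 oC2] [cC1 cC2] [[a Ca] [b Cb]] d AE]; split.
- by split; rewrite -reeb_openE.
- by split; apply: reeb_preim_connected => //; left.
- have [x xa] := reeb_quot_surj a; have [y yb] := reeb_quot_surj b.
  by split; [exists x|exists y]; rewrite /preimage /= ?xa ?yb.
- by rewrite -preimage_setI d preimage_set0.
- by rewrite -preimage_setU -AE.
Qed.

(** A connected fibre cannot meet both pieces, so the pieces are saturated and their images remain
    open and disjoint. *)
Lemma pieces_image (A C1 C2 : set X) z : saturated f A ->
  pieces (A `\` q @^-1` [set z]) C1 C2 ->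
  pieces (q @` A `\` [set z]) (q @` C1) (q @` C2).
Proof.
move=> /saturatedP sA p; have pC := piecesC p.
have sat C D : pieces (A `\` q @^-1` [set z]) C D -> saturated f C.
  move=> pCD; apply/saturatedP => x y xy Cx.
  have [Ax nxz] : (A `\` q @^-1` [set z]) x by case: pCD => _ _ _ _ ->; left.
  have : q @^-1` [set q x] `<=` C.
    apply: (pieces_connected pCD); first exact: reeb_fibre_connected.
      move=> t /= tx; split; first exact: sA (esym tx) Ax.
      by move=> /= tz; apply: nxz; rewrite /preimage/= -tx.
    by exists x.
  by apply; rewrite /preimage/=.
have s1 := sat _ _ p; have s2 := sat _ _ pC.
case: p => [[oC1 oC2] [cC1 cC2] [[a Ca] [b Cb]] d AE]; split.
- by split; exact: open_image_saturated.
- by split; apply: connected_continuous_connected => //;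
    apply: continuous_subspaceT; exact: reeb_quot_continuous.
- by split; [exists (q a); exists a|exists (q b); exists b].
- apply/seteqP; split => // _ [[x C1x <-] [y C2y yx]].
  by apply: (disjoint_notin d C1x); exact: (saturatedP C2).1 s2 _ _ yx C2y.
- rewrite -image_setU -AE; apply/seteqP; split.
    by move=> _ [[x Ax <-] nz]; exists x.
  by move=> _ [x [Ax nz] <-]; split => //; exists x.
Qed.

End reeb_quotient.
Arguments reeb_map {R X} f w.

(** * The Reeb space of a continuous function on a Peano continuum *)

Section reeb_peano.
Context {R : realType} {X : topologicalType} (f : X -> R).
Hypotheses (X_peano : peano_continuum X) (f_cont : continuous f).
Local Notation W := (reeb_space f).
Local Notation q := (reeb_quot f).

Let X_compact : compact [set: X]. Proof. by case: X_peano. Qed.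
Let X_lc : locally_connected X. Proof. by case: X_peano. Qed.
Let X_T2 : hausdorff_space X. Proof. by case: X_peano. Qed.

Lemma reeb_compact : compact [set: W].
Proof.
have -> : [set: W] = q @` [set: X].
  by apply/seteqP; split => // w _; have [x <-] := reeb_quot_surj w; exists x.
apply: continuous_compact => //; apply: continuous_subspaceT.
exact: reeb_quot_continuous.
Qed.

Lemma reeb_component_saturated (A : set X) x : saturated f A ->
  saturated f (connected_component A x).
Proof.
move=> sA; apply/saturatedP => y z yz Axy.
have Ay := connected_component_sub Axy; apply: connected_component_trans Axy _.
apply: (connected_in_component (reeb_fibre_connected (w := q y))) => //.
by move=> t /= ty; exact: (saturatedP f A).1 sA _ _ (esym ty) Ay.
Qed.

Lemma reeb_locally_connected : locally_connected W.
Proof.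
move=> w N; rewrite nbhsE => -[Q [oQ Qw] QN].
have [x xw] := reeb_quot_surj w.
have oqQ : open (q @^-1` Q) by rewrite -reeb_openE.
exists (q @` connected_component (q @^-1` Q) x); split.
- apply: open_image_saturated; last exact: open_component.
  exact/reeb_component_saturated/saturated_preim.
- apply: connected_continuous_connected; first exact: component_connected.
  apply: continuous_subspaceT; exact: reeb_quot_continuous.
- by exists x => //; apply: connected_component_refl; rewrite /preimage/= xw.
- by move=> _ [y /connected_component_sub Qy <-]; exact: QN.
Qed.

Lemma reeb_map_continuous : continuous (reeb_map f).
Proof.
apply/quotient_continuous.
rewrite (_ : _ \o _ = f)//; apply/funext => x /=; exact: reeb_mapE.
Qed.

(* If [x] and [y] lie on the same level [t] and in the same component of every
   [f @^-1` `]t - e, t + e[], then the decreasing intersection of the closures of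
   these components is a connected subset of the level containing both. *)
Lemma reeb_hausdorff : hausdorff_space W.
Proof.
rewrite open_hausdorff => w w' /eqP ww'.
suff [U [V [oU oV Uw Vw' UV]]] : exists U V : set W,
    [/\ open U, open V, U w, V w' & U `&` V = set0].
  by exists (U, V); split => //=; rewrite ?inE//; exact/eqP.
have [x xw] := reeb_quot_surj w; have [y yw'] := reeb_quot_surj w'.
have [fxy|fxy] := pselect (f x = f y); last first.
  have [U [V [oU oV Ux Vy UV]]] := hausdorff_sep (@Rhausdorff R) fxy.
  exists (reeb_map f @^-1` U), (reeb_map f @^-1` V); split.
  - by apply: open_comp => // z _; exact: reeb_map_continuous.
  - by apply: open_comp => // z _; exact: reeb_map_continuous.
  - by rewrite /preimage/= -xw reeb_mapE.
  - by rewrite /preimage/= -yw' reeb_mapE.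
  - by rewrite -preimage_setI UV preimage_set0.
pose B e := f @^-1` `](f x - e), (f x + e)[.
have oB e : open (B e) by apply: open_comp => // z _; exact: f_cont.
have sB e : saturated f (B e).
  by apply/saturatedP => u v /reeb_quotP[uv _]; rewrite /B /preimage/= uv.
pose C e z := connected_component (B e) z.
(* Either some band around the level separates the points, by components that are open and
   saturated, or the set [K] below joins them. *)
have [[e e0 nCy]|H] := pselect (exists2 e, 0 < e & ~ C e x y).
  have sC z : saturated f (C e z) by exact: reeb_component_saturated.
  have Bx z : f x = f z -> B e z.
    by move=> xz; rewrite /B /preimage/= in_itv/= -xz; lra.
  exists (q @` C e x), (q @` C e y); split.
  - by apply: open_image_saturated => //; exact: open_component.
  - by apply: open_image_saturated => //; exact: open_component.
  - by exists x => //; apply: connected_component_refl; exact: Bx.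
  - by exists y => //; apply: connected_component_refl; exact: Bx.
  - apply/seteqP; split => // _ [[u Cu <-] [v Cv vu]]; apply: nCy.
    apply: connected_component_trans Cu _; apply: connected_component_sym.
    exact: (saturatedP f _).1 (sC y) _ _ vu Cv.
exfalso; apply: ww'; rewrite -xw -yw'; apply/reeb_quotP; split => //.
have Cxy e : 0 < e -> C e x y.
  by move=> e0; apply: contrapT => nC; apply: H; exists e.
pose K := \bigcap_(e in [set e : R | 0 < e]) closure (C e x).
have cK : closed K by apply: closed_bigI => e _; exact: closed_closure.
have Kx : K x.
  move=> e /= e0; apply/subset_closure/connected_component_refl.
  by rewrite /B /preimage/= in_itv/=; lra.
have Ky : K y by move=> e /= e0; exact/subset_closure/Cxy.
have Kf : K `<=` f @^-1` [set f x].
  move=> z Kz /=; apply/eqP; rewrite -subr_eq0 -normr_le0; apply/ler_addgt0Pl => e e0.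
  rewrite addr0.
  have cD : closed (f @^-1` `[f x - e, f x + e]).
    by apply: closed_comp => [u _|]; [exact: f_cont|exact: interval_closed].
  have : (f @^-1` `[f x - e, f x + e]) z.
    apply: cD; apply: closureS (Kz e e0) => u /connected_component_sub.
    by rewrite /B /preimage/= !in_itv/= => /andP[/ltW -> /ltW ->].
  by rewrite /preimage/= in_itv/= ler_norml; lra.
exists K => //; split => //.
apply: connected_intro => [|U V hUV KE UV [u Uu]]; first by right.
have [cU cV] : closed U /\ closed V.
  case: hUV => -[hU hV] //; split.
    rewrite (_ : U = K `\` V); first exact: closedD_open.
    by rewrite KE setDUl setDv setU0; apply/esym/setDidPl.
  rewrite (_ : V = K `\` U); first exact: closedD_open.
  by rewrite KE setDUl setDv set0U; apply/esym/setDidPl; rewrite setIC.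
apply: contrapT => /eqP/set0P[v Vv].
have [Q [Q' [oQ oQ' UQ VQ' QQ']]] :=
  (@normal_openP R _).1 (compact_normal X_T2 X_compact) _ _ cU cV UV.
have /compact_near_coveringP nc : compact (~` (Q `|` Q')).
  by apply: (subclosed_compact _ X_compact) => //; apply: open_closedC; exact: openU.
(* Each point outside [Q] and [Q'] leaves the closure for small [e], uniformly by compactness. The
   connected closure then lies in [Q] alone, although it contains [v]. *)
have Hn : \forall e \near (0:R)^'+, ~` (Q `|` Q') `<=` ~` closure (C e x).
  apply: (nc R _ (fun e z => (~` closure (C e x)) z)) => z nQ.
  have nKz : ~ K z by rewrite KE => -[/UQ|/VQ'] ?; apply: nQ; [left|right].
  have [e e0 nCz] : exists2 e : R, 0 < e & ~ closure (C e x) z.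
    by apply: contrapT => nex; apply: nKz => e e0; apply: contrapT => nc'; apply: nex; exists e.
  exists (~` closure (C e x), [set e' | e' < e]) => /=.
    split; last exact: nbhs_right_lt.
    apply: open_nbhs_nbhs; split => //; apply: closed_openC; exact: closed_closure.
  move=> [z' e'] /= [nz' ee'] cz'; apply: nz'; apply: closureS cz' => t [D [Dx DB cD] Dt].
  exists D => //; split => // s /DB; rewrite /B /preimage/= !in_itv/=; lra.
have [e [He e0]] := filter_ex (filterI Hn (nbhs_right_gt (0:R))).
have : closure (C e x) `<=` Q.
  apply: (@connected_open_cover _ _ _ Q') => //.
  - apply: connected_closure; exact: component_connected.
  - by move=> z cz; apply: contrapT => nQ; exact: (He z nQ cz).
  - by move=> z _; exact: disjoint_notin.
  - exists u; split; last exact: UQ.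
    have : K u by rewrite KE; left.
    by apply.
have Kv : K v by rewrite KE; right.
by move=> /(_ _ (Kv e e0)) Qv; apply: (disjoint_notin QQ' Qv); exact: VQ'.
Qed.

(** The closure of [S] stays in one fibre of [reeb_map f]. Being closed and connected it has a
    connected preimage, which lies in one level of [f] and hence in one contour. *)
Lemma reeb_map_light (S : set W) : connected S ->
  (forall w w', S w -> S w' -> reeb_map f w = reeb_map f w') ->
  forall w w', S w -> S w' -> w = w'.
Proof.
move=> cS Sc w w' Sw Sw'.
have Sf v : closure S v -> reeb_map f v = reeb_map f w.
  have cl : closed (reeb_map f @^-1` [set reeb_map f w]).
    apply: closed_comp => [z _|]; first exact: reeb_map_continuous.
    exact: closed_eq.
  move=> Sv; have : (reeb_map f @^-1` [set reeb_map f w]) v; last by [].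
  by apply: cl; apply: closureS Sv => z Sz; exact: Sc.
have cq : connected (q @^-1` closure S).
  apply: reeb_preim_connected; first by right; exact: closed_closure.
  exact: connected_closure.
have [x xw] := reeb_quot_surj w; have [y yw'] := reeb_quot_surj w'.
rewrite -xw -yw'; apply/reeb_quotP; split.
  by rewrite -(reeb_mapE f x) -(reeb_mapE f y) xw yw'; exact: Sc.
apply: connected_in_component cq _ _ _.
- by move=> z Sz; rewrite /preimage/= -(reeb_mapE f z) -(reeb_mapE f x) xw; exact: Sf.
- by rewrite /preimage/= xw; exact: subset_closure.
- by rewrite /preimage/= yw'; exact: subset_closure.
Qed.

Lemma reeb_dense_sequence : @second_countable X ->
  exists d : nat -> W, forall U : set W, open U -> U !=set0 -> exists n, U (d n).
Proof.
move=> [B /countable_injP[i iB] [Bo Bb]].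
have [[x0 _] _ _ _ _] := X_peano.
(* One point is taken from each non-empty basic set; numbers that code none get [x0]. *)
have /choice[d dP] : forall n, exists x, forall S, B S -> i S = n -> S !=set0 -> S x.
  move=> n; have [[S [BS iS [x Sx]]]|H] := pselect (exists S, [/\ B S, i S = n & S !=set0]).
    by exists x => S' BS' iS' _; rewrite (iB S' S) ?inE// iS' iS.
  by exists x0 => S BS iS S0; exfalso; apply: H; exists S.
exists (q \o d) => U oU [w Uw]; have [x xw] := reeb_quot_surj w.
have [|S [BS Sx] SU] := Bb x (q @^-1` U).
  by apply: open_nbhs_nbhs; split; [rewrite -reeb_openE|rewrite /preimage/= xw].
exists (i S); apply: SU; apply: dP => //; by exists x.
Qed.

Lemma reeb_map_bounded : exists M, forall w, `|reeb_map f w| <= M.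
Proof.
have : bounded_set (reeb_map f @` [set: W]).
  apply: compact_bounded; apply: continuous_compact; last exact: reeb_compact.
  apply: continuous_subspaceT; exact: reeb_map_continuous.
move=> [M [_ HM]]; exists (M + 1) => w; apply: (HM (M + 1)); last by exists w.
by rewrite ltrDl.
Qed.

End reeb_peano.

Lemma star_like_is_finite_graph (R : realType) (X : topologicalType) (f : X -> R) :
  peano_continuum X -> @second_countable X -> continuous f ->
  (forall L : set X, contour f L -> exists2 U : set X, star_like f U & L `<=` U) ->
  is_finite_graph R (reeb_space f).
Proof.
move=> X_peano X_sc f_cont H.
have X_lc : locally_connected X by case: X_peano.
have W_compact := @reeb_compact R X f X_peano.
have W_T2 := reeb_hausdorff X_peano f_cont.
have W_lc := @reeb_locally_connected R X f X_peano.
have g_cont := reeb_map_continuous f_cont.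
have g_light := reeb_map_light f_cont.
have g_bd := reeb_map_bounded X_peano f_cont.
have [d d_dense] := @reeb_dense_sequence R X f X_peano X_sc.
apply: graph_of_arcs => //; apply: compact_local => //.
- exact: covered_by_arcs0.
- exact: covered_by_arcsW.
- exact: covered_by_arcsU.
move=> w; have [x xw] := reeb_quot_surj w.
have [|U [oU cU sU [L [[y Ly] LU [n [C [Ccyl Ctriv UL]]]]]] xU] := H (contour_of f x); first by exists x.
have arcC i : exists (k : R -> reeb_space f) (a b : R), open_arc k a b (reeb_quot f @` C i).
  have [[t Ct] oC cC sC C2] := Ccyl i.
  apply: (cut_open_arc W_lc W_T2 g_cont g_light d_dense g_bd).
  - exact: open_image_saturated.
  - apply: connected_continuous_connected => //; apply: continuous_subspaceT.
    exact: reeb_quot_continuous.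
  - by exists (reeb_quot f t); exists t.
  - move=> z /C2 /card_pieces[//||A [B AB]].
      apply: openD_closed => //; apply/(reeb_closedE [set z]).
      exact/accessible_closed_set1/hausdorff_accessible.
    by exists (reeb_quot f @` A), (reeb_quot f @` B); exact: pieces_image.
have Lz : reeb_quot f @^-1` [set reeb_quot f y] = L by rewrite reeb_fibre.
have Cw w' : (reeb_quot f @` U) w' -> w' <> reeb_quot f y ->
    exists i, (reeb_quot f @` C i) w'.
  move=> [u Uu uw'] wy; have : (U `\` L) u.
    by split => //; rewrite -Lz /preimage/= uw'.
  by rewrite UL => -[i _ Ci]; exists i, u.
have Ux : U x by apply: xU; exact: connected_component_refl.
(* A point other than the centre lies on an open arm; only the centre needs [star_covered]. *)
have [xy|nxy] := pselect (w = reeb_quot f y); last first.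
  have [|i [u Cu uw]] := Cw w _ nxy; first by exists x.
  have [k [a [b kab]]] := arcC i.
  by apply: (open_arc_covered kab); exists u.
apply: (@star_covered _ _ W_compact W_T2 n (fun i => reeb_quot f @` C i) w (reeb_quot f @` U)) => //.
- exact: open_image_saturated.
- by exists x.
- apply/seteqP; split => w'.
    by move=> [Uw' /= nw]; have [|i Ci] := Cw w' Uw'; [rewrite -xy|exists i].
  move=> [i _ [u Cu <-]]; have [Uu nLu] : (U `\` L) u by rewrite UL; exists i.
  split; first by exists u.
  by move=> /= E; apply: nLu; rewrite -Lz /preimage/= E.
- move=> i j _ _ [_ [[u Cu <-] [v Cv vu]]].
  apply: Ctriv => //; exists u; split => //.
  by have [_ _ _ /saturatedP sC _] := Ccyl j; exact: sC vu Cv.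
Qed.

(** * Stars in a graph *)

Section star_like_pullback.
Context {R : realType} {X : topologicalType} (f : X -> R) {Y : topologicalType}.
Variables (h : reeb_space f -> Y) (k : Y -> reeb_space f).
Hypotheses (hK : cancel h k) (kK : cancel k h).
Hypotheses (h_cont : continuous h) (k_cont : continuous k).

Let Q (x : X) := h (reeb_quot f x).

Let preimE (A : set Y) : h @^-1` A = k @` A.
Proof.
apply/seteqP; split => [w Aw|_ [y Ay <-]]; first by exists (h w).
by rewrite /preimage/= kK.
Qed.

Let openh (A : set Y) : open A -> open (h @^-1` A).
Proof. by move=> oA; apply: open_comp => // w _; exact: h_cont. Qed.

Let connh (A : set Y) : connected A -> connected (h @^-1` A).
Proof.
move=> cA; rewrite preimE; apply: connected_continuous_connected => //.
exact: continuous_subspaceT.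
Qed.

(** The counterpart in the graph of a cylindrical set. *)
Definition cut_arc (D : set Y) := [/\ D !=set0, open D, connected D &
  forall z, D z -> exists A B, pieces (D `\` [set z]) A B].

Let pieces_h (D A B : set Y) w : pieces (D `\` [set h w]) A B ->
  pieces (h @^-1` D `\` [set w]) (h @^-1` A) (h @^-1` B).
Proof.
move=> [[oA oB] [cA cB] [[a Aa] [b Bb]] d DE]; split.
- by split; exact: openh.
- by split; exact: connh.
- by split; [exists (k a)|exists (k b)]; rewrite /preimage/= kK.
- by rewrite -preimage_setI d preimage_set0.
- rewrite -preimage_setU -DE; apply/seteqP; split=> v [Dv nv]; split => //.
    by move=> /= /(can_inj hK).
  by move=> /= E; apply: nv; rewrite /preimage/= E.
Qed.

Lemma cut_arc_cylindrical D : cut_arc D ->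
  cylindrical f (reeb_quot f @^-1` (h @^-1` D)).
Proof.
move=> [[y Dy] oD cD cut]; split.
- have [x xy] := reeb_quot_surj (k y).
  by exists x; rewrite /preimage/= xy kK.
- by rewrite -reeb_openE; exact: openh.
- by apply: reeb_preim_connected; [left; exact: openh|exact: connh].
- exact: saturated_preim.
- move=> _ [x Dx <-]; have [A [B AB]] := cut _ Dx.
  exact/pieces_card/pieces_preim/pieces_h/AB.
Qed.

(** Arms may be indexed by any finite type, such as the half-edges at a vertex; [enum_val] renumbers
    them. *)
Lemma star_pullback (T : finType) (N : set Y) (c : Y) (D : T -> set Y) :
  open N -> connected N -> N c -> N `\` [set c] = \bigcup_t D t ->
  trivIset setT D -> (forall t, cut_arc (D t)) ->
  star_like f (reeb_quot f @^-1` (h @^-1` N)).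
Proof.
move=> oN cN Nc ND tD cutD; split.
- by rewrite -reeb_openE; exact: openh.
- by apply: reeb_preim_connected; [left; exact: openh|exact: connh].
- exact: saturated_preim.
- have [x xc] := reeb_quot_surj (k c).
  have LE : reeb_quot f @^-1` [set k c] = contour_of f x by rewrite -reeb_fibre xc.
  exists (contour_of f x); split; first by exists x.
    by rewrite -LE => z /= zc; rewrite /preimage/= zc kK.
  exists #|T|, (fun i => reeb_quot f @^-1` (h @^-1` D (enum_val i))); split.
  + by move=> i; exact: cut_arc_cylindrical.
  + move=> i j _ _ [z [Di Dj]]; apply: enum_val_inj; apply: tD => //.
    by exists (h (reeb_quot f z)).
  + rewrite -LE; apply/seteqP; split => z.
      move=> [Nz nz]; have : (N `\` [set c]) (h (reeb_quot f z)).
        by split => //= E; apply: nz; rewrite /preimage/= -E hK.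
      rewrite ND => -[t _ Dt]; exists (enum_rank t) => //.
      by rewrite enum_rankK.
    move=> [i _ Di]; have : (N `\` [set c]) (h (reeb_quot f z)).
      by rewrite ND; exists (enum_val i).
    by move=> [Nz nz]; split => // /= E; apply: nz; rewrite /= E kK.
Qed.

End star_like_pullback.

(** * Open stars of vertices and of interior points of edges *)

Section realization_stars.
Context {R : realType} {G : finite_multigraph}.
Implicit Types (e : edge G) (v : vertex G) (a b t : R).

Lemma edge_value_mid e t : 0 < t < 1 -> edge_value e t = inr (e, t).
Proof. by move=> /andP[t0 t1]; rewrite /edge_value !leNgt t0 t1. Qed.

Lemma redge_inj e e' t t' : 0 < t < 1 -> 0 < t' < 1 ->
  redge e t = redge e' t' -> e = e' /\ t = t'.
Proof.
move=> t01 t01' /(congr1 (@place R G)).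
by rewrite !place_redge !edge_value_mid// => -[].
Qed.

Lemma redge_not_vertex e t v : 0 < t < 1 -> redge e t <> rvertex v.
Proof.
move=> t01 /(congr1 (@place R G)).
by rewrite place_redge place_rvertex edge_value_mid.
Qed.

Lemma redge_src e : redge e 0 = rvertex (edge_src e) :> realization R G.
Proof. by apply: place_inj; rewrite place_redge place_rvertex /edge_value lexx. Qed.

Lemma redge_tgt e : redge e 1 = rvertex (edge_tgt e) :> realization R G.
Proof.
by apply: place_inj; rewrite place_redge place_rvertex /edge_value ler10 lexx.
Qed.

Lemma redge_open e a b : 0 <= a -> b <= 1 ->
  open (redge e @` `]a, b[ : set (realization R G)).
Proof.
move=> a0 b1.
have -> : redge e @` `]a, b[ = @place R G @^-1` [set p | exists2 t, a < t < b & p = inr (e, t)].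
  apply/seteqP; split => [_ [t + <-]|z [t tab zt]].
    rewrite /= in_itv/= => tab; rewrite /preimage/= place_redge edge_value_mid.
      by exists t.
    by lra.
  exists t; first by rewrite /= in_itv.
  by apply: place_inj; rewrite place_redge edge_value_mid//; lra.
apply: realization_open => e'.
exists (if e' == e then `]a, b[%classic else set0).
  by case: ifP => _; [exact: interval_open|exact: open0].
move=> t t01; case: eqP => [->|ne]; split => //=.
- move=> [s sab]; rewrite /edge_value in_itv/=.
  by case: (leP t 0) => // t0; case: (leP 1 t) => // t1 [->].
- rewrite in_itv/= => tab; exists t => //; rewrite edge_value_mid//; lra.
- move=> [s sab]; rewrite /edge_value.
  by case: (leP t 0) => // t0; case: (leP 1 t) => // t1 [] /ne.
Qed.

Lemma redge_connected e (A : set R) : is_interval A ->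
  connected (redge e @` A : set (realization R G)).
Proof.
move=> iA; apply: connected_continuous_connected; first exact/connected_intervalP.
apply: continuous_subspaceT; exact: redge_continuous.
Qed.

Lemma redge_pieces e a b t : 0 <= a -> b <= 1 -> a < t < b ->
  pieces (redge e @` `]a, b[ `\` [set redge e t] : set (realization R G))
    (redge e @` `]a, t[) (redge e @` `]t, b[).
Proof.
move=> a0 b1 /andP[at_ tb].
have inj u w : a < u < b -> a < w < b -> redge e u = redge e w -> u = w.
  by move=> uab vab /redge_inj[]//; lra.
split.
- by split; apply: redge_open => //; lra.
- by split; apply: redge_connected; exact: interval_is_interval.
- split; [exists (redge e ((a + t) / 2))|exists (redge e ((t + b) / 2))].
    by exists ((a + t) / 2) => //; rewrite /= in_itv/=; lra.
  by exists ((t + b) / 2) => //; rewrite /= in_itv/=; lra.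
- apply/seteqP; split => // _ [[u + <-] [v + vu]]; rewrite /= !in_itv/= => uI vI.
  have := inj v u _ _ vu; lra.
- apply/seteqP; split.
    move=> _ [[u + <-]]; rewrite /= in_itv/= => uI ut.
    have [{}ut|tu|E] := ltgtP u t.
    + by left; exists u => //; rewrite /= in_itv/=; lra.
    + by right; exists u => //; rewrite /= in_itv/=; lra.
    + by exfalso; apply: ut; rewrite E.
  move=> _ [[u + <-]|[u + <-]]; rewrite /= in_itv/= => uI; split.
  + by exists u => //; rewrite /= in_itv/=; lra.
  + move=> /= E; have := inj u t _ _ E; lra.
  + by exists u => //; rewrite /= in_itv/=; lra.
  + move=> /= E; have := inj u t _ _ E; lra.
Qed.

Lemma redge_cut_arc e a b : 0 <= a -> a < b -> b <= 1 ->
  cut_arc (redge e @` `]a, b[ : set (realization R G)).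
Proof.
move=> a0 ab b1; split.
- by exists (redge e ((a + b) / 2)), ((a + b) / 2) => //; rewrite /= in_itv/=; lra.
- exact: redge_open.
- by apply: redge_connected; exact: interval_is_interval.
- move=> _ [t + <-]; rewrite /= in_itv/= => tab.
  by exists (redge e @` `]a, t[), (redge e @` `]t, b[); exact: redge_pieces.
Qed.

(** Edges are cut at their midpoint so that a loop provides two disjoint arms at its vertex. *)
Definition half_edge (p : edge G * bool) : set (realization R G) :=
  redge p.1 @` (if p.2 then `]2^-1, 1[%classic else `]0, 2^-1[%classic).

Definition half_edge_end (p : edge G * bool) :=
  if p.2 then edge_tgt p.1 else edge_src p.1.

Definition vertex_star v : set (realization R G) :=
  [set rvertex v] `|` \bigcup_(p in [set p | half_edge_end p = v]) half_edge p.

Lemma half_edgeP p z : half_edge p z -> exists2 t, 0 < t < 1 /\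
  (if p.2 then 2^-1 < t else t < 2^-1) & z = redge p.1 t.
Proof.
by case: p => e [] [t + <-]; rewrite /= in_itv/= => tI; exists t => //; lra.
Qed.

Lemma vertex_star_open v : open (vertex_star v).
Proof.
pose S : set (vertex G + edge G * R) := [set p | p = inl v \/
  exists e t, [/\ 0 < t < 1, p = inr (e, t) &
    (edge_src e = v /\ t < 2^-1) \/ (edge_tgt e = v /\ 2^-1 < t)]].
have -> : vertex_star v = @place R G @^-1` S.
  apply/seteqP; split.
    move=> z [->|[[e c] /= pv /half_edgeP[/= t [t01 tc] ->]]].
      by left; rewrite place_rvertex.
    right; exists e, t; split => //; first by rewrite place_redge edge_value_mid.
    by case: c pv tc; rewrite /half_edge_end/= => pv tc; [right|left].
  move=> z [zv|[e [t [t01 zt H]]]].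
    by left; apply: place_inj; rewrite place_rvertex.
  right; have -> : z = redge e t.
    by apply: place_inj; rewrite place_redge edge_value_mid.
  case: H => -[ev tc]; [exists (e, false) => //|exists (e, true) => //];
    by exists t => //=; rewrite in_itv/=; lra.
apply: realization_open => e.
(* For a loop at [v] both ends contribute. *)
exists ((if edge_src e == v then [set t | t < 2^-1] else set0) `|`
        (if edge_tgt e == v then [set t | 2^-1 < t] else set0)).
  apply: openU; case: ifP => _; try exact: open0.
    exact: open_lt.
  exact: open_gt.
move=> t /andP[t0 t1]; split.
  move=> [|[e' [t' [t01 + H]]]]; rewrite /edge_value.
    case: (leP t 0) => [t0' [->]|t0']; first by left; rewrite eqxx /=; lra.
    by case: (leP 1 t) => // t1' [->]; right; rewrite eqxx /=; lra.
  case: (leP t 0) => // t0'; case: (leP 1 t) => // t1' [-> ->].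
  by case: H => -[-> tc]; [left|right]; rewrite eqxx.
case: eqP => [ev|_]; case: eqP => [ev'|_]; rewrite ?setU0 ?set0U => H.
- have [t0'|t0'] := leP t 0; first by left; rewrite /edge_value t0' ev.
  have [t1'|t1'] := leP 1 t; first by left; rewrite /edge_value leNgt t0'/= t1' ev'.
  right; exists e, t; rewrite edge_value_mid ?t0' ?t1'//; split => //.
  by case: H => /= H; [left|right].
- have [t0'|t0'] := leP t 0; first by left; rewrite /edge_value t0' ev.
  have t1' : t < 1 by move: H => /=; lra.
  right; exists e, t; rewrite edge_value_mid ?t0' ?t1'//; split => //.
  by left.
- have t0' : 0 < t by move: H => /=; lra.
  have [t1'|t1'] := leP 1 t; first by left; rewrite /edge_value leNgt t0'/= t1' ev'.
  right; exists e, t; rewrite edge_value_mid ?t0' ?t1'//; split => //.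
  by right.
- by [].
Qed.

Lemma vertex_star_connected v : connected (vertex_star v).
Proof.
(* [None] stands for the bare vertex, so that the union is not empty at an isolated vertex. *)
pose D (o : option (edge G * bool)) : set (realization R G) :=
  if o is Some p then [set rvertex v] `|` half_edge p else [set rvertex v].
pose P : set (option (edge G * bool)) :=
  [set o | if o is Some p then half_edge_end p = v else True].
have -> : vertex_star v = \bigcup_(o in P) D o.
  apply/seteqP; split => z.
    by move=> [zv|[p pv pz]]; [exists None|exists (Some p) => //; right].
  move=> [[p|] /= Pp]; last by left.
  by move=> [->|pz]; [left|right; exists p].
apply: bigcup_connected.
  by exists (rvertex v) => -[p|] _ //; left.
move=> [[e c]|] /= pv; last exact: connected1.
have E : [set rvertex v] `|` half_edge (e, c) =
    redge e @` (if c then `]2^-1, 1]%classic else `[0, 2^-1[%classic).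
  apply/seteqP; split.
    move=> z [->|]; rewrite /half_edge /=.
      case: c pv; rewrite /half_edge_end/= => <-.
        by exists 1; rewrite ?redge_tgt//= in_itv/=; lra.
      by exists 0; rewrite ?redge_src//= in_itv/=; lra.
    by move=> [t + <-]; case: c {pv} => /=; rewrite in_itv/= => tI; exists t => //=;
      rewrite in_itv/=; lra.
  move=> _ [t + <-]; rewrite /half_edge /=.
  case: c pv; rewrite /half_edge_end/= in_itv/= => pv /andP[t1 t2].
    have [t3|t3] := ltP t 1; first by right; exists t => //=; rewrite in_itv/=; lra.
    by left; rewrite /= -pv -redge_tgt; congr redge; lra.
  have [t3|t3] := ltP 0 t; first by right; exists t => //=; rewrite in_itv/=; lra.
  by left; rewrite /= -pv -redge_src; congr redge; lra.
rewrite E; apply: redge_connected; case: c {pv E}; exact: interval_is_interval.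
Qed.

Lemma half_edge_cut_arc p : cut_arc (half_edge p).
Proof. by case: p => e []; apply: redge_cut_arc; lra. Qed.

Lemma half_edge_disjoint p p' z : half_edge p z -> half_edge p' z -> p = p'.
Proof.
case: p p' => [e c] [e' c'] /half_edgeP[/= t [t01 tc] ->] /half_edgeP[/= t' [t01' tc'] E].
have [-> tt'] := redge_inj t01 t01' E.
by case: c c' tc tc' => [] [] // tc tc'; exfalso; lra.
Qed.

Lemma half_edge_not_vertex p v : ~ half_edge p (rvertex v).
Proof. by move=> /half_edgeP[t [t01 _] /esym]; exact: redge_not_vertex. Qed.

End realization_stars.

Lemma finite_graph_star_like (R : realType) (X : topologicalType) (f : X -> R) :
  is_finite_graph R (reeb_space f) ->
  forall L : set X, contour f L -> exists2 U : set X, star_like f U & L `<=` U.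
Proof.
move=> [G [h [k [hK kK hc kc]]]] _ [x ->].
suff [N sN Nx] : exists2 N : set (realization R G),
    star_like f (reeb_quot f @^-1` (h @^-1` N)) & N (h (reeb_quot f x)).
  by exists (reeb_quot f @^-1` (h @^-1` N)) => //; rewrite -reeb_fibre => z /= ->.
have pull := star_pullback hK kK hc kc.
case: (realization_cases (h (reeb_quot f x))) => [[v ->]|[e [t [/andP[t0 t1] ->]]]].
  exists (vertex_star v); last by left.
  pose T := {p : edge G * bool | half_edge_end p == v}.
  apply: (pull T _ (rvertex v) (fun p => half_edge (val p))).
  - exact: vertex_star_open.
  - exact: vertex_star_connected.
  - by left.
  - apply/seteqP; split => [z [[//|[p pv pz]] _]|z [p _ pz]].
      have pv' : half_edge_end p == v by apply/eqP.
      by exists (exist _ p pv').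
    split; first by right; exists (val p) => //; exact/eqP/(valP p).
    by move=> /= zv; apply: (@half_edge_not_vertex R G (val p) v); rewrite -zv.
  - by move=> p p' _ _ [z [pz pz']]; apply: val_inj; exact: half_edge_disjoint pz pz'.
  - by move=> p; exact: half_edge_cut_arc.
(* At an interior point of an edge the star is the whole open edge, with two arms. *)
have t01 : 0 < t < 1 by rewrite t0.
have [_ _ _ d E] := redge_pieces e (lexx 0) (lexx 1) t01.
exists (redge e @` `]0, 1[); last by exists t => //; rewrite /= in_itv.
apply: (pull bool _ (redge e t) (fun c : bool => redge e @` (if c then `]0, t[%classic else `]t, 1[%classic))).
- exact: redge_open.
- by apply: redge_connected; exact: interval_is_interval.
- by exists t => //; rewrite /= in_itv.
- rewrite E; apply/seteqP; split => [z [Hz|Hz]|z [[] _ Hz]].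
  + by exists true.
  + by exists false.
  + by left.
  + by right.
- move=> [] [] _ _ //= [z [z1 z2]]; exfalso.
    exact: disjoint_notin d _ z1 z2.
  exact: disjoint_notin d _ z2 z1.
- by move=> []; apply: redge_cut_arc => //; exact: ltW.
Qed.

Theorem theorem2p12 (R : realType) (X : topologicalType) (f : X -> R)
    (X_peano : peano_continuum X) (X_second_countable : @second_countable X)
    (f_continuous : continuous f) :
  is_finite_graph R (reeb_space f) <->
  (forall L : set X, contour f L -> exists2 U : set X, star_like f U & L `<=` U).
Proof.
split; first exact: finite_graph_star_like.
exact: star_like_is_finite_graph.
Qed.
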